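(* Let $\mathcal{H}$ be a complex Hilbert space and let $T_i\in\mathcal{B}(\mathcal{H})$ for $i=1,2,3,4$. If $f,g$ are nonnegative continuous functions on $[0,\infty)$ satisfying $f(x)g(x)=x$ for all $x\ge0$, then $$\begin{aligned}\left\|\begin{bmatrix} T_1 & T_2\\ T_3 & T_4\end{bmatrix}\right\|&\le\frac12\Big(\left\|f^2(|T_1|)+f^2(|T_3|)\right\|+\left\|g^2(|T_1^*|)+g^2(|T_2^*|)\right\|\\&\qquad+\left\|f^2(|T_2|)+f^2(|T_4|)\right\|+\left\|g^2(|T_3^*|)+g^2(|T_4^*|)\right\|\Big).\end{aligned}$$ In particular, for any $0\le t\le1$, $$\begin{aligned}\left\|\begin{bmatrix} T_1 & T_2\\ T_3 & T_4\end{bmatrix}\right\|&\le\frac12\Big(\left\||T_1|^{2t}+|T_3|^{2t}\right\|+\left\||T_1^*|^{2(1-t)}+|T_2^*|^{2(1-t)}\right\|\\&\qquad+\left\||T_2|^{2t}+|T_4|^{2t}\right\|+\left\||T_3^*|^{2(1-t)}+|T_4^*|^{2(1-t)}\right\|\Big).\end{aligned}$$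
   Context: $\mathcal{B}(\mathcal{H})$ denotes the algebra of bounded linear operators on $\mathcal{H}$, $\|\cdot\|$ is the operator norm, and the $2\times2$ operator matrix acts on $\mathcal{H}\oplus\mathcal{H}$. For an operator $X$, $|X|=(X^*X)^{1/2}$; functions and powers of positive operators are defined by the continuous functional calculus, with $f^2(|X|)=(f(|X|))^2$ and $|X|^0=I$ (the identity). *)

(* Defs.v *)
From HB Require Import structures.
From mathcomp Require Import all_boot all_order all_algebra ring.
From mathcomp Require Import complex.
From mathcomp Require Import all_classical all_reals all_analysis.

Set Implicit Arguments.
Unset Strict Implicit.
Unset Printing Implicit Defensive.

Import Order.TTheory GRing.Theory Num.Theory.
Import numFieldNormedType.Exports.

Local Open Scope classical_set_scope.
Local Open Scope ring_scope.
Local Open Scope complex_scope.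

HB.mixin Record CompleteNormedModule_isHilbert (R : realType) V
    & CompleteNormedModule R[i] V := {
  inner : {dot V for Num.conj} ;
  inner_normE : forall x : V, `|x| ^+ 2 = inner x x
}.

(* Inner products are linear in the first argument. *)
#[short(type="hilbertType")]
HB.structure Definition Hilbert (R : realType) :=
  {V of CompleteNormedModule R[i] V & CompleteNormedModule_isHilbert R V}.

(* Bounded operators, as continuous linear maps (linear_bounded_continuous). *)
#[short(type="bounded_linear")]
HB.structure Definition BoundedLinear (K : numDomainType)
    (V W : normedModType K) :=
  {f of @GRing.Linear K V W *:%R f & @isContinuous V W f}.

Section bounded_linear_module.
Context {K : numFieldType} {V W : normedModType K}.
Implicit Types f g h : bounded_linear V W.

Lemma bounded_linearP f g : f =1 g -> f = g.
Proof.
case: f g => [f [[?] [?] [?]]] [g d]/= /funext fg; subst g.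
case: d => [[?] [?] [?]]; congr BoundedLinear.Pack.
by congr BoundedLinear.Class; f_equal; exact: Prop_irrelevance.
Qed.

HB.instance Definition _ := gen_eqMixin (bounded_linear V W).
HB.instance Definition _ := gen_choiceMixin (bounded_linear V W).

Let continuous0 : continuous (\0 : V -> W).
Proof. by move=> x; exact: cvg_cst. Qed.
HB.instance Definition _ := isContinuous.Build V W \0 continuous0.

Let continuousN f : continuous (\- f).
Proof. by move=> x; apply: cvgN; exact: cts_fun. Qed.
HB.instance Definition _ f := isContinuous.Build V W (\- f) (@continuousN f).

Let continuousD f g : continuous (f \+ g).
Proof. by move=> x; apply: cvgD; exact: cts_fun. Qed.
HB.instance Definition _ (f g : bounded_linear V W) :=
  isContinuous.Build V W (f \+ g) (@continuousD f g).

Let continuousZ (a : K) f : continuous (a \*: f).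
Proof. by move=> x; apply: cvgZr; exact: cts_fun. Qed.
HB.instance Definition _ a f :=
  isContinuous.Build V W (a \*: f) (@continuousZ a f).

Let add f g : bounded_linear V W := f \+ g.
Let opp f : bounded_linear V W := \- f.
Let zero : bounded_linear V W := \0.
Let scale a f : bounded_linear V W := a \*: f.

Let addA : associative add.
Proof. by move=> f g h; apply: bounded_linearP => x; exact: addrA. Qed.
Let addC : commutative add.
Proof. by move=> f g; apply: bounded_linearP => x; exact: addrC. Qed.
Let add0 : left_id zero add.
Proof. by move=> f; apply: bounded_linearP => x; exact: add0r. Qed.
Let addN : left_inverse zero opp add.
Proof. by move=> f; apply: bounded_linearP => x; exact: addNr. Qed.

HB.instance Definition _ :=
  GRing.isZmodule.Build (bounded_linear V W) addA addC add0 addN.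

Let scaleA a b f : scale a (scale b f) = scale (a * b) f.
Proof. by apply: bounded_linearP => x; exact: scalerA. Qed.
Let scale1 : left_id 1 scale.
Proof. by move=> f; apply: bounded_linearP => x; exact: scale1r. Qed.
Let scaleDr : right_distributive scale +%R.
Proof. by move=> a f g; apply: bounded_linearP => x; exact: scalerDr. Qed.
Let scaleDl f : {morph scale^~ f : a b / a + b}.
Proof. by move=> a b; apply: bounded_linearP => x; exact: scalerDl. Qed.

HB.instance Definition _ := GRing.Zmodule_isLmodule.Build K
  (bounded_linear V W) scaleA scale1 scaleDr scaleDl.

End bounded_linear_module.

Notation "''B' ( V )" := (bounded_linear V V)
  (at level 8, format "''B' ( V )") : type_scope.

(* Ring multiplication is composition. *)
Section bounded_linear_ring.
Context {K : numFieldType} {V : normedModType K}.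

Let continuousM (f g : 'B(V)) : continuous (f \o g).
Proof. by move=> x; apply: continuous_comp; exact: cts_fun. Qed.
HB.instance Definition _ (f g : 'B(V)) :=
  isContinuous.Build V V (f \o g) (@continuousM f g).

Let continuous1 : continuous (idfun : V -> V).
Proof. by move=> x. Qed.
HB.instance Definition _ := isContinuous.Build V V idfun continuous1.

Let mul (f g : 'B(V)) : 'B(V) := f \o g.
Let one : 'B(V) := idfun.

Let mulA : associative mul. Proof. by move=> f g h; exact: bounded_linearP. Qed.
Let mul1 : left_id one mul. Proof. by move=> f; exact: bounded_linearP. Qed.
Let mulr1 : right_id one mul. Proof. by move=> f; exact: bounded_linearP. Qed.
Let mulDl : left_distributive mul +%R.
Proof. by move=> f g h; exact: bounded_linearP. Qed.
Let mulDr : right_distributive mul +%R.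
Proof. by move=> f g h; apply: bounded_linearP => x; exact: linearD. Qed.

HB.instance Definition _ := GRing.Zmodule_isPzRing.Build 'B(V)
  mulA mul1 mulr1 mulDl mulDr.

End bounded_linear_ring.

Lemma sqrtC_minkowski (C : numClosedFieldType) (a b c d : C) :
    0 <= a -> 0 <= b -> 0 <= c -> 0 <= d ->
  sqrtC ((a + c) ^+ 2 + (b + d) ^+ 2) <=
  sqrtC (a ^+ 2 + b ^+ 2) + sqrtC (c ^+ 2 + d ^+ 2).
Proof.
move=> a0 b0 c0 d0; have p0 (x y : C) : 0 <= x -> 0 <= y -> 0 <= x ^+ 2 + y ^+ 2.
  by move=> x0 y0; rewrite addr_ge0// exprn_ge0.
have s0 (x y : C) : 0 <= x -> 0 <= y -> 0 <= sqrtC (x ^+ 2 + y ^+ 2).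
  by move=> x0 y0; rewrite sqrtC_ge0 p0.
rewrite -(@ler_sqr C) ?nnegrE ?addr_ge0// ?s0 ?addr_ge0//.
rewrite sqrtCK [leRHS]sqrrD !sqrtCK.
have -> : (a + c) ^+ 2 + (b + d) ^+ 2 =
    a ^+ 2 + b ^+ 2 + (a * c + b * d) *+ 2 + (c ^+ 2 + d ^+ 2) by ring.
rewrite lerD2r lerD2l ler_pMn2r//.
rewrite -(@ler_sqr C) ?nnegrE ?addr_ge0 ?mulr_ge0 ?s0//.
rewrite exprMn !sqrtCK -subr_ge0.
have -> : (a ^+ 2 + b ^+ 2) * (c ^+ 2 + d ^+ 2) - (a * c + b * d) ^+ 2 =
    (a * d - b * c) ^+ 2 by ring.
by rewrite real_exprn_even_ge0// rpredB// rpredM// ger0_real.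
Qed.

(* Hilbert direct sum: V * W itself already carries the sup norm, so the norm
   sqrt (`|x|^2 + `|y|^2) is put on an alias. *)
Definition hsum (V W : Type) : Type := (V * W)%type.

Section hilbert_sum.
Context {R : realType} {V W : hilbertType R}.

HB.instance Definition _ := GRing.Lmodule.copy (hsum V W) (V * W)%type.

Let norm (x : hsum V W) : R[i] := sqrtC (`|x.1| ^+ 2 + `|x.2| ^+ 2).

Let ler_norm_hsum x y : norm (x + y) <= norm x + norm y.
Proof.
apply: le_trans (sqrtC_minkowski _ _ _ _) => //.
by rewrite ler_sqrtC ?nnegrE ?addr_ge0 ?exprn_ge0// lerD//
  lerXn2r ?nnegrE ?addr_ge0// ler_normD.
Qed.

Let norm_hsumZ (a : R[i]) x : norm (a *: x) = `|a| * norm x.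
Proof.
rewrite /norm /= !normrZ !exprMn -mulrDr rootCMl ?exprn_ge0//.
by rewrite sqrCK.
Qed.

Let norm_hsum_eq0 x : norm x = 0 -> x = 0.
Proof.
move/eqP; rewrite sqrtC_eq0 paddr_eq0 ?exprn_ge0// !sqrf_eq0 !normr_eq0.
by case: x => a b /= /andP[/eqP -> /eqP ->].
Qed.

HB.instance Definition _ := Lmodule_isNormed.Build R[i] (hsum V W)
  ler_norm_hsum norm_hsumZ norm_hsum_eq0.

Lemma norm_hsumE (x : hsum V W) : `|x| = sqrtC (`|x.1| ^+ 2 + `|x.2| ^+ 2).
Proof. by []. Qed.

Lemma norm_hsum_le1 (x : hsum V W) : `|x.1| <= `|x|.
Proof.
rewrite norm_hsumE -[leLHS]sqrCK// ler_sqrtC ?nnegrE ?addr_ge0 ?exprn_ge0//.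
by rewrite lerDl exprn_ge0.
Qed.

Lemma norm_hsum_le2 (x : hsum V W) : `|x.2| <= `|x|.
Proof.
rewrite norm_hsumE -[leLHS]sqrCK// ler_sqrtC ?nnegrE ?addr_ge0 ?exprn_ge0//.
by rewrite lerDr exprn_ge0.
Qed.

Lemma norm_hsum_le (x : hsum V W) : `|x| <= `|x.1| + `|x.2|.
Proof.
have n0 : 0 <= `|x.1| + `|x.2| by rewrite addr_ge0.
rewrite norm_hsumE -[leRHS]sqrCK// ler_sqrtC ?nnegrE ?addr_ge0 ?exprn_ge0//.
by rewrite sqrrD addrAC lerDl mulrn_wge0// mulr_ge0.
Qed.

Lemma cvg_hsum (F : set_system (hsum V W)) {FF : Filter F} (l : hsum V W) :
  x.1 @[x --> F] --> l.1 -> x.2 @[x --> F] --> l.2 -> F --> l.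
Proof.
move=> /cvgrPdist_lt F1 /cvgrPdist_lt F2.
apply/fcvgrPdist_lt => e e0; have e20 : 0 < e / 2 by rewrite divr_gt0.
near=> x; apply: le_lt_trans (norm_hsum_le _) _.
by rewrite (splitr e) ltrD//; near: x; [exact: F1|exact: F2].
Unshelve. all: by end_near. Qed.

Let hsum_complete (F : set_system (hsum V W)) :
  ProperFilter F -> cauchy F -> cvg F.
Proof.
move=> FF /cauchyP cF.
have c1 : cauchy (x.1 @[x --> F]).
  apply/cauchyP => e e0; have [x Fx] := cF e e0; exists x.1.
  suff: F [set y : hsum V W | ball x.1 e y.1] by [].
  apply: filterS Fx => y; rewrite -!ball_normE/=; apply: le_lt_trans.
 exact: norm_hsum_le1 (x - y).
have c2 : cauchy (x.2 @[x --> F]).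
  apply/cauchyP => e e0; have [x Fx] := cF e e0; exists x.2.
  suff: F [set y : hsum V W | ball x.2 e y.2] by [].
  apply: filterS Fx => y; rewrite -!ball_normE/=; apply: le_lt_trans.
  exact: norm_hsum_le2 (x - y).
apply/cvg_ex; exists (lim (x.1 @[x --> F]), lim (x.2 @[x --> F])).
by apply: cvg_hsum; [exact: cauchy_cvg c1|exact: cauchy_cvg c2].
Qed.

HB.instance Definition _ := Uniform_isComplete.Build (hsum V W) hsum_complete.

Definition hsum_inner (x y : hsum V W) : R[i] :=
  inner x.1 y.1 + inner x.2 y.2.

Let hsum_innerB : bilinear_for *%R (Num.conj \; *%R) hsum_inner.
Proof.
split=> [y a x z|x a y z]; rewrite /hsum_inner/=.
  by rewrite !linearPl/= mulrDr addrACA.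
by rewrite !linearPr/= mulrDr addrACA.
Qed.
HB.instance Definition _ := bilinear_isBilinear.Build R[i] (hsum V W)
  (hsum V W) R[i] *%R (Num.conj \; *%R) hsum_inner hsum_innerB.

Let hsum_innerC x y :
  hsum_inner x y = (-1) ^+ false * Num.conj (hsum_inner y x).
Proof.
by rewrite /hsum_inner rmorphD/= mul1r; congr (_ + _);
  rewrite hermC mul1r.
Qed.
HB.instance Definition _ := isHermitianSesquilinear.Build R[i] (hsum V W)
  false Num.conj hsum_inner hsum_innerC.

Let hsum_normE (x : hsum V W) : `|x| ^+ 2 = hsum_inner x x.
Proof. by rewrite norm_hsumE sqrtCK !inner_normE. Qed.

Let hsum_inner_gt0 x : x != 0 -> 0 < hsum_inner x x.
Proof. by move=> x0; rewrite -hsum_normE exprn_gt0// normr_gt0. Qed.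
HB.instance Definition _ :=
  isDotProduct.Build R[i] (hsum V W) hsum_inner hsum_inner_gt0.

HB.instance Definition _ := CompleteNormedModule_isHilbert.Build R (hsum V W)
  hsum_normE.

End hilbert_sum.

Section block_operator.
Context {R : realType} {V : hilbertType R}.

Definition block_op (A B C D : V -> V) (x : hsum V V) : hsum V V :=
  (A x.1 + B x.2, C x.1 + D x.2).

Variables (A B C D : 'B(V)).

Let block_op_linear : linear (block_op A B C D).
Proof.
by move=> a x y; apply: injective_projections => /=;
  rewrite !linearP scalerDr addrACA.
Qed.
HB.instance Definition _ := GRing.isLinear.Build R[i] (hsum V V) (hsum V V)
  *:%R (block_op A B C D) block_op_linear.

Let cvg_hsum1 (x : hsum V V) : y.1 @[y --> x] --> x.1.
Proof.
apply/(@cvgrPdist_lt _ _ _ (nbhs x)) => e e0; near=> y.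
apply: (le_lt_trans (norm_hsum_le1 (x - y))).
by near: y; exact: cvgr_dist_lt.
Unshelve. all: by end_near. Qed.

Let cvg_hsum2 (x : hsum V V) : y.2 @[y --> x] --> x.2.
Proof.
apply/(@cvgrPdist_lt _ _ _ (nbhs x)) => e e0; near=> y.
apply: (le_lt_trans (norm_hsum_le2 (x - y))).
by near: y; exact: cvgr_dist_lt.
Unshelve. all: by end_near. Qed.

Let block_op_continuous : continuous (block_op A B C D).
Proof.
have cvg_op (S T : 'B(V)) (x : hsum V V) :
    S y.1 + T y.2 @[y --> x] --> S x.1 + T x.2.
  apply: (@cvgD _ _ _ (nbhs x)).
    exact: continuous_cvg (cts_fun _) (@cvg_hsum1 x).
  exact: continuous_cvg (cts_fun _) (@cvg_hsum2 x).
move=> x; apply: (@cvg_hsum _ _ _ (fmap (block_op A B C D) (nbhs x)) _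
  (block_op A B C D x) (@cvg_op A B x) (@cvg_op C D x)).
by apply: fmap_filter; exact: nbhs_filter.
Qed.
HB.instance Definition _ := isContinuous.Build (hsum V V) (hsum V V)
  (block_op A B C D) block_op_continuous.

Definition opmx : 'B(hsum V V) := block_op A B C D.

End block_operator.

Section operators.
Context {R : realType}.

(* complex.Re: the norm of a normed space over R[i] is R[i]-valued. *)
Definition opnorm {V W : normedModType R[i]} (T : bounded_linear V W) : R :=
  sup [set complex.Re `|T x| | x in [set x | `|x| <= 1]].

Context {H : hilbertType R}.
Implicit Types (T A B : 'B(H)) (f : R -> R).

(* The default value 0 is never used: the set is a singleton by Riesz. *)
Definition adjoint T : 'B(H) :=
  xget 0 [set S : 'B(H) | forall x y, inner (T x) y = inner x (S y)].

Definition spectrum A : set R[i] :=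
  [set z | ~ exists B : 'B(H),
    B * (A - z *: (1 : 'B(H))) = 1 /\ (A - z *: (1 : 'B(H))) * B = 1].

Definition op_horner (p : {poly R}) A : 'B(H) :=
  \sum_(i < size p) (p`_i)%:C *: A ^+ i.

(* Continuous functional calculus: B is the norm limit of p_n(A) for real
   polynomials p_n converging to f uniformly on the spectrum of A. It is meant
   for self-adjoint A, whose spectrum is real, and f continuous on the spectrum
   of A; then B exists and is unique. *)
Definition is_cfc f A B : Prop :=
  exists p : {poly R}^nat,
    {uniform [set x : R | spectrum A x%:C], (fun n x => (p n).[x]) @ \oo --> f}
    /\ opnorm (op_horner (p n) A - B) @[n --> \oo] --> (0 : R).

Definition cfc f A : 'B(H) := xget 0 (is_cfc f A).

Definition opabs T : 'B(H) := cfc Num.sqrt (adjoint T * T).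

(* powR satisfies 0 `^ 0 = 1, so that oppow A 0 is the identity. *)
Definition oppow A (s : R) : 'B(H) := cfc (fun x => x `^ s) A.

End operators.

(* Main.v *)
From HB Require Import structures.
Require Import Defs.
From mathcomp Require Import all_boot all_order all_algebra complex.
From mathcomp Require Import all_classical all_reals all_analysis.
From mathcomp Require Import ring lra.

Import Order.TTheory GRing.Theory Num.Theory.
Import numFieldNormedType.Exports.

Local Open Scope classical_set_scope.
Local Open Scope ring_scope.
Set Implicit Arguments.
Unset Strict Implicit.
Unset Printing Implicit Defensive.

(** The proof rests on the mixed Schwarz inequality
    [Re <T x, y> <= `|f(|T|) x| * `|g(|T*|) y|], for [f] and [g] with product [x]
    ([mixed_schwarz]). Applied to the four entries of the matrix, and followed by
    the inequality [2 a b <= a ^+ 2 + b ^+ 2], it bounds [Re <T X, Y>], for vectors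
    [X] and [Y] of norm at most 1, by half the sum of the four quadratic forms of
    the operators on the right-hand side, evaluated at the components of [X] and
    [Y] ([opnorm_opmx_le]). Powers are the case [f(x) = x ^ t],
    [g(x) = x ^ (1 - t)].

    Formally, [T = T k(|T|) f(|T|)] with [k = 1 / f]. Moving [k(|T|)] across the
    inner product leaves [k(|T|) T* y = T* k(|T*|) y], whose norm is that of
    [|T*| k(|T*|) y = g(|T*|) y]. As [f] may vanish at 0, [k] is replaced by
    [g(x) / (x + e)], with an error that vanishes with [e].

    This uses a functional calculus of positive operators that is multiplicative,
    compatible with intertwining relations, and bounded in norm by the supremum
    of the function. Its source is
    the estimate [opnorm_horner_le]: for a positive [A] and a real polynomial [p],
    the norm of [p(A)] is at most the supremum of [`|p|] on the part of the
    spectrum in [[0, `|A|]]. The norm [m] of [p(A)] is such that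
    [p(A) ^+ 2 - m ^+ 2] is not bounded below; factoring this polynomial over the
    complex numbers, one of the factors [A - z] is not bounded below, and for
    positive [A] this forces [z] to be real, in the interval, and in the
    spectrum. Together with Weierstrass approximation ([weierstrass]) and
    completeness of the operator algebra ([op_complete]), the estimate gives
    existence of the calculus on the interval ([approx_cfc_ex]). The calculus
    supplies inverses of [A - r] for [r] outside the interval, so the real
    spectrum lies in the interval ([spectrum_range]) and the calculus agrees with
    the one defined on the spectrum ([cfcE]). Adjoints exist by Riesz
    representation ([riesz_real]). *)

(** * Real-valued norms and the operator norm *)

Section real_norm.
Local Open Scope complex_scope.
Context {R : realType}.

(** The norm of an [R[i]]-module takes its values in [R[i]]. All estimates below
    are made with this real copy, where the order is total and [lra] applies. *)
Definition nrm {V : normedModType R[i]} (x : V) : R := complex.Re `|x|.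

Lemma normE (V : normedModType R[i]) (x : V) : `|x| = (nrm x)%:C.
Proof. by rewrite /nrm RRe_real// normr_real. Qed.

Section basic.
Context {V : normedModType R[i]}.
Implicit Types x y : V.

Lemma nrm_ge0 x : 0 <= nrm x.
Proof. by rewrite -ler0c -normE. Qed.

Lemma nrm0 : nrm (0 : V) = 0.
Proof. by rewrite /nrm normr0. Qed.

Lemma nrm_eq0 x : (nrm x == 0) = (x == 0).
Proof. by rewrite -[RHS]normr_eq0 normE eq_complex /= eqxx andbT. Qed.

Lemma nrm_gt0 x : (0 < nrm x) = (x != 0).
Proof. by rewrite lt_def nrm_eq0 nrm_ge0 andbT. Qed.

Lemma nrmD x y : nrm (x + y) <= nrm x + nrm y.
Proof. by have := ler_normD x y; rewrite !normE -rmorphD /= lecR. Qed.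

Lemma nrmN x : nrm (- x) = nrm x.
Proof. by rewrite /nrm normrN. Qed.

Lemma nrmB x y : nrm (x - y) <= nrm x + nrm y.
Proof. by rewrite -(nrmN y) nrmD. Qed.

Lemma nrmZ (a : R) x : nrm (a%:C *: x) = `|a| * nrm x.
Proof.
apply: complexI; rewrite rmorphM /= -!normE normrZ; congr (_ * _).
by rewrite normc_def /= expr0n /= addr0 sqrtr_sqr.
Qed.

Lemma nrmZC (a : R[i]) x : nrm (a *: x) = complex.Re `|a| * nrm x.
Proof.
apply: complexI; rewrite rmorphM /= -!normE normrZ; congr (_ * _).
Qed.

End basic.

Section operator_norm.
Context {V W : normedModType R[i]}.
Implicit Types (T : bounded_linear V W).

Lemma bounded_linear_nrm T : exists2 M : R, 0 <= M & forall x, nrm (T x) <= M * nrm x.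
Proof.
have /(@continuous_linear_bounded _ _ _ 0)/linear_boundedP : {for 0, continuous T}.
  exact: cts_fun.
move=> /pinfty_ex_gt0 [r r0 Tr].
have rE : r = (complex.Re r)%:C by rewrite RRe_real// gtr0_real.
exists (complex.Re r) => [|x]; first by rewrite -ler0c -rE ltW.
by have := Tr x; rewrite !normE {1}rE -rmorphM /= lecR.
Qed.

Let opset T := [set complex.Re `|T x| | x in [set x : V | `|x| <= 1]].

Lemma opnorm_has_sup T : has_sup (opset T).
Proof.
split; first by exists (complex.Re `|T 0|), 0 => //=; rewrite normr0.
have [M M0 TM] := bounded_linear_nrm T; exists M => _ [x /= x1 <-].
apply: le_trans (TM x) _; rewrite ler_piMr//.
by move: x1; rewrite normE -(rmorph1 (real_complex R)) /= lecR.
Qed.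

Lemma nrm_op T x : nrm (T x) <= opnorm T * nrm x.
Proof.
have [->|x0] := eqVneq x 0; first by rewrite linear0 !nrm0 mulr0.
rewrite -ler_pdivrMr ?nrm_gt0//.
apply: (ub_le_sup (opnorm_has_sup T).2).
exists (((nrm x)^-1)%:C *: x) => /=.
  rewrite normE nrmZ -(rmorph1 (real_complex R)) /= lecR ger0_norm ?invr_ge0 ?nrm_ge0//.
  by rewrite mulVf// nrm_eq0.
by rewrite linearZ/= -/(nrm _) nrmZ mulrC ger0_norm// invr_ge0 nrm_ge0.
Qed.

Lemma opnorm_ge0 T : 0 <= opnorm T.
Proof.
apply: (ub_le_sup (opnorm_has_sup T).2); exists 0 => /=; first by rewrite normr0.
by rewrite linear0 normr0.
Qed.

Lemma opnorm_le_unit T c : (forall x, nrm x <= 1 -> nrm (T x) <= c) -> opnorm T <= c.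
Proof.
move=> Tc; apply: ge_sup; first exact: (opnorm_has_sup T).1.
move=> _ [x /= x1 <-]; apply: Tc.
by move: x1; rewrite normE -(rmorph1 (real_complex R)) /= lecR.
Qed.

Lemma opnorm_le T c : 0 <= c -> (forall x, nrm (T x) <= c * nrm x) -> opnorm T <= c.
Proof.
move=> c0 Tc; apply: opnorm_le_unit => x x1; apply: le_trans (Tc x) _.
by rewrite ler_piMr.
Qed.

Lemma nrm_continuous (f : {linear V -> W}) (c : R) :
  (forall x, nrm (f x) <= c * nrm x) -> continuous f.
Proof.
move=> fc; apply: bounded_linear_continuous; apply/linear_boundedP.
near=> r => x; rewrite !normE; apply: (@le_trans _ _ (c%:C * (nrm x)%:C)).
  by rewrite -rmorphM /= lecR.
rewrite ler_wpM2r ?ler0c ?nrm_ge0//; near: r.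
exists c%:C; split=> [|r /ltW //]; by apply/complex_realP; exists c.
Unshelve. all: by end_near. Qed.

End operator_norm.
End real_norm.

(** * The real inner product *)

Section real_inner.
Local Open Scope complex_scope.
Context {R : realType} {H : hilbertType R}.
Implicit Types (x y z : H) (T A : 'B(H)).

(** The real part of [inner] makes [H] a real Hilbert space. It determines
    [inner], since the imaginary part of [inner x y] is [- ip ('i *: x) y], so
    adjoints and self-adjointness can be tested with it. *)
Definition ip x y : R := complex.Re (inner x y).

Lemma ReD (a b : R[i]) : complex.Re (a + b) = complex.Re a + complex.Re b.
Proof. by case: a b => [? ?] [? ?]. Qed.

Lemma ReJ (a : R[i]) : complex.Re (Num.conj a) = complex.Re a.
Proof. by case: a. Qed.

Lemma ipDl x y z : ip (x + y) z = ip x z + ip y z.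
Proof. by rewrite /ip linearDl ReD. Qed.

Lemma ipDr x y z : ip z (x + y) = ip z x + ip z y.
Proof. by rewrite /ip linearDr ReD. Qed.

Lemma ReN (a : R[i]) : complex.Re (- a) = - complex.Re a.
Proof. by case: a. Qed.

Lemma ipNl x z : ip (- x) z = - ip x z.
Proof. by rewrite /ip linearNl ReN. Qed.

Lemma ipNr x z : ip z (- x) = - ip z x.
Proof. by rewrite /ip linearNr ReN. Qed.

Lemma ReZ (c : R) (a : R[i]) : complex.Re (c%:C * a) = c * complex.Re a.
Proof. by case: a => a b /=; rewrite mul0r subr0. Qed.

Lemma ipZl (c : R) x z : ip (c%:C *: x) z = c * ip x z.
Proof. by rewrite /ip linearZl_LR /= ReZ. Qed.

Lemma ip_sym x y : ip x y = ip y x.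
Proof. by rewrite /ip hermC mul1r ReJ. Qed.

Lemma ipZr (c : R) x z : ip z (c%:C *: x) = c * ip z x.
Proof. by rewrite ip_sym ipZl ip_sym. Qed.

Lemma ip0l x : ip 0 x = 0.
Proof. by rewrite /ip linear0l. Qed.

Lemma ip0r x : ip x 0 = 0.
Proof. by rewrite ip_sym ip0l. Qed.

Lemma ip_nrm x : ip x x = nrm x ^+ 2.
Proof.
apply: complexI; rewrite rmorphXn /= -normE inner_normE /ip RRe_real//.
by rewrite -inner_normE ger0_real// exprn_ge0.
Qed.

Lemma ip_i x y : ip ('i%C *: x) y = - complex.Im (inner x y).
Proof. by rewrite /ip linearZl_LR /= mulrC ReiNIm. Qed.

Lemma ip_i2 x y : ip ('i%C *: x) ('i%C *: y) = ip x y.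
Proof.
rewrite ip_i linearZr_LR /= /ip; case: (inner x y) => a b /=.
by rewrite !mul0r mulN1r opprD opprK oppr0 add0r.
Qed.

(** Testing with [c] equal to 1 and to the imaginary unit recovers the real and
    the imaginary part. *)
Lemma ip_inner x y z t : (forall c : R[i], ip (c *: x) y = ip (c *: z) t) ->
  inner x y = inner z t.
Proof.
move=> h; have := h 1; have := h 'i%C; rewrite !ip_i !scale1r /ip => /oppr_inj.
by case: (inner x y) (inner z t) => a b [c d] /= -> ->.
Qed.

Lemma cauchy_schwarz x y : ip x y <= nrm x * nrm y.
Proof.
have [->|y0] := eqVneq y 0.
  by rewrite nrm0 mulr0 ip_sym /ip linear0l.
have [->|x0] := eqVneq x 0.
  by rewrite nrm0 mul0r /ip linear0l.
have hx : 0 < nrm x by rewrite nrm_gt0.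
have hy : 0 < nrm y by rewrite nrm_gt0.
pose u := (nrm y)%:C *: x - (nrm x)%:C *: y.
have : 0 <= ip u u by rewrite ip_nrm sqr_ge0.
rewrite /u !(ipDl, ipDr, ipNl, ipNr, ipZl, ipZr) !ip_nrm (ip_sym y x) => h.
suff : 0 <= (nrm x * nrm y) * (2 * (nrm x * nrm y - ip x y)).
  by rewrite pmulr_rge0 ?mulr_gt0// pmulr_rge0// subr_ge0.
by apply: le_trans h _; rewrite le_eqVlt; apply/orP; left; apply/eqP; ring.
Qed.

Lemma ip_ext x y : (forall z, ip z x = ip z y) -> x = y.
Proof.
move=> h; apply/eqP; rewrite -subr_eq0 -nrm_eq0 -sqrf_eq0 -ip_nrm.
by rewrite ipDr ipNr h subrr.
Qed.

Lemma nrm_parallelogram x y :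
  nrm (x + y) ^+ 2 + nrm (x - y) ^+ 2 = 2 * nrm x ^+ 2 + 2 * nrm y ^+ 2.
Proof. by rewrite -!ip_nrm !(ipDl, ipDr, ipNl, ipNr); ring. Qed.

End real_inner.

(** * Riesz representation and adjoints *)

Section completeness.
Local Open Scope complex_scope.
Context {R : realType}.

(** Completeness of a space normed in [R[i]], stated with real tolerances. *)
Lemma nrm_complete (V : completeNormedModType R[i]) (u : nat -> V) :
  (forall e : R, 0 < e -> exists n, forall m k, (n <= m)%N -> (n <= k)%N ->
    nrm (u m - u k) <= e) ->
  exists l, forall e : R, 0 < e -> exists n, forall m, (n <= m)%N ->
    nrm (u m - l) <= e.
Proof.
move=> uC.
have : cauchy (u @ \oo).
  apply/cauchyP => e e0.
  have eE : e = (complex.Re e)%:C by rewrite RRe_real// gtr0_real.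
  have re0 : 0 < complex.Re e by rewrite -ltcR -eE.
  have [n un] := uC _ (divr_gt0 re0 (ltr0Sn R 1)).
  exists (u n); exists n => // m /= nm.
  rewrite -ball_normE /ball_ /= normE eE ltcR.
  apply: le_lt_trans (un n m (leqnn _) nm) _.
  by rewrite ltr_pdivrMr// ltr_pMr// ltr1n.
move=> /cauchy_cvg /cvg_ex [l ul]; exists l => e e0.
have /cvgrPdist_le /(_ e%:C) := ul; rewrite ltcR => /(_ e0) [n _ nP].
by exists n => m nm; have := nP m nm; rewrite /= normE lecR -opprB nrmN.
Qed.

End completeness.

Section riesz.
Local Open Scope complex_scope.
Context {R : realType} {H : hilbertType R}.
Implicit Types (x y z : H).

(** The functional is represented by the minimiser of
    [J x = nrm x ^+ 2 - 2 * f x]. A minimising sequence is Cauchy by the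
    parallelogram law, and the first variation of [J] vanishes at its limit.
    Working with [J] avoids orthogonal projections onto the kernel of [f]. *)
Lemma riesz_real (f : H -> R) (c : R) :
  {morph f : x y / x + y} -> (forall (a : R) x, f (a%:C *: x) = a * f x) ->
  (forall x, `|f x| <= c * nrm x) -> exists y, forall x, f x = ip x y.
Proof.
move=> fD fZ fc.
pose J x := nrm x ^+ 2 - 2 * f x.
have J_lb x : - c ^+ 2 <= J x.
  rewrite /J; have := fc x; rewrite ler_norml => /andP[_ h].
  have := sqr_ge0 (nrm x - c); nra.
pose S := [set J x | x in setT].
have Sinf : has_inf S.
  split; first by exists (J 0), 0.
  by exists (- c ^+ 2) => _ [x _ <-].
pose m := inf S.
have mJ x : m <= J x by apply: (ge_inf Sinf.2); exists x.
have near_min (e : R) : 0 < e -> exists x, J x < m + e.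
  by move=> e0; have [_ [x _ <-]] := inf_adherent e0 Sinf; exists x.
have u_ex (n : nat) : {x | J x < m + n.+1%:R^-1}.
  by apply: cid; apply: near_min; rewrite invr_gt0.
pose u n := sval (u_ex n).
have uP n : J (u n) < m + n.+1%:R^-1 := svalP (u_ex n).
have f2 x : f ((2^-1 : R)%:C *: x) = 2^-1 * f x by rewrite fZ.
have fN x : f (- x) = - f x.
  by rewrite -mulN1r -fZ rmorphN /= rmorph1 scaleN1r.
(* The parallelogram law: near-minimisers of [J] are near each other. *)
have Jmid x y : nrm (x - y) ^+ 2 <= 2 * (J x - m) + 2 * (J y - m).
  have := mJ ((2^-1 : R)%:C *: (x + y)); rewrite /J f2 nrmZ fD exprMn.
  have := nrm_parallelogram x y.
  rewrite ger0_norm ?invr_ge0// => h1 h2.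
  lra.
have [|y uy] := @nrm_complete R H u.
  move=> e e0.
  have e20 : 0 < e ^+ 2 / 4 by rewrite divr_gt0// exprn_gt0.
  have [n nP] : exists n : nat, n.+1%:R^-1 <= e ^+ 2 / 4.
    have [n _ nn] := near_infty_natSinv_lt (PosNum e20).
    by exists n; apply: ltW; exact: nn n (leqnn n).
  exists n => i j ni nj.
  rewrite -(@ler_pXn2r _ 2) ?nnegrE ?nrm_ge0// ?(ltW e0)//.
  have lew k : (n <= k)%N -> J (u k) - m <= e ^+ 2 / 4.
    move=> nk; rewrite lerBlDl; apply: le_trans (ltW (uP k)) _.
    rewrite lerD2l; apply: le_trans nP; rewrite lef_pV2 ?posrE ?ltr0n//.
    by rewrite ler_nat ltnS.
  by have := Jmid (u i) (u j); have := lew i ni; have := lew j nj; lra.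
have c0 : 0 <= `|c| by [].
(* Since [J] is continuous, the limit [y] of the minimising sequence [u] is a
   minimiser. *)
have JyE : forall e : R, 0 < e -> J y <= m + e.
  move=> e e0.
  pose K := nrm y + `|c| + 1.
  have K0 : 0 < K by rewrite /K; have := nrm_ge0 y; lra.
  pose d := Num.min 1 (e / (4 * K)).
  have d0 : 0 < d by rewrite lt_min ltr01 divr_gt0// mulr_gt0.
  have [n1 n1P] := uy d d0.
  have [n2 _ n2P] := near_infty_natSinv_lt (PosNum (divr_gt0 e0 (ltr0Sn R 1))).
  pose n := maxn n1 n2.
  have h1 := n1P n (leq_maxl _ _).
  have h2 : n.+1%:R^-1 < e / 2 := n2P n (leq_maxr _ _).
  have h3 := uP n.
  set w := u n - y in h1.
  have uE : u n = y + w by rewrite /w addrC subrK.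
  clearbody w.
  have : J y <= J (u n) + 2 * d * K.
    rewrite /J uE fD -!ip_nrm !(ipDl, ipDr) (ip_sym y w) !ip_nrm.
    have := fc w; rewrite ler_norml => /andP[_ fw].
    have cs := cauchy_schwarz (- w) y.
    rewrite ipNl nrmN in cs.
    have w0 := nrm_ge0 w; have y0 := nrm_ge0 y.
    have cc : c <= `|c| by exact: ler_norm.
    have : nrm w * nrm y <= d * nrm y by rewrite ler_wpM2r.
    have : c * nrm w <= `|c| * d.
      by apply: (@le_trans _ _ (`|c| * nrm w)); rewrite ?ler_wpM2r ?ler_wpM2l.
    rewrite /K; have := sqr_ge0 (nrm w); nra.
  have : 2 * d * K <= e / 2.
    have : d <= e / (4 * K) by rewrite ge_min lexx orbT.
    by rewrite ler_pdivlMr ?mulr_gt0//; lra.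
  move: h2 h3; move: (J y) (J (u n)) (2 * d * K) (n.+1%:R^-1) => a1 a2 a3 a4.
  by clear; clearbody m => h2 h3 h4 h5; lra.
have Jy x : J y <= J x.
  apply: le_trans (mJ x); apply/ler_addgt0Pr => e e0; exact: JyE.
exists y => h.
have quad (s : R) : 0 <= s ^+ 2 * nrm h ^+ 2 + s * (2 * (ip h y - f h)).
  have := Jy (y + s%:C *: h).
  rewrite /J fD fZ -!ip_nrm !(ipDl, ipDr, ipZl, ipZr) (ip_sym y h).
  by rewrite !ip_nrm; lra.
apply/eqP; rewrite eq_sym -subr_eq0; apply/eqP.
move: (ip h y - f h) quad => b quad.
have N1 : 0 < nrm h ^+ 2 + 1 by rewrite ltr_wpDl// sqr_ge0.
(* This value of [s] makes the quadratic negative unless [b] is 0; the summand 1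
   covers the case where [nrm h] vanishes. *)
have := quad (- b / (nrm h ^+ 2 + 1)).
set q := nrm h ^+ 2 in N1 *.
have -> : (- b / (q + 1)) ^+ 2 * q + - b / (q + 1) * (2 * b) =
   - (b ^+ 2 * ((q + 2) / (q + 1) ^+ 2)).
  by field; rewrite gt_eqF.
rewrite oppr_ge0 pmulr_lle0; last first.
  by rewrite divr_gt0 ?exprn_gt0//; have := sqr_ge0 (nrm h); rewrite -/q; lra.
by move=> h2; apply/eqP; rewrite -sqrf_eq0 eq_le h2 sqr_ge0.
Qed.

End riesz.

Lemma bounded_linear_of (R : realType) (V W : normedModType (complex R))
    (F : V -> W) (c : R) :
  linear F -> (forall x, nrm (F x) <= c * nrm x) ->
  exists T : bounded_linear V W, T =1 F.
Proof.
move=> Flin Fc.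
pose L : {linear V -> W} := HB.pack F (GRing.isLinear.Build _ _ _ _ F Flin).
have Lc : continuous L by exact: (@nrm_continuous _ _ _ L c).
pose T : bounded_linear V W := HB.pack F L (isContinuous.Build V W F Lc).
by exists T.
Qed.

Section adjoint.
Local Open Scope complex_scope.
Context {R : realType} {H : hilbertType R}.
Implicit Types (x y z : H) (T A S : 'B(H)).

(** Riesz representation of [x |-> ip (T x) y], for each [y]; the
    representing vector depends linearly and boundedly on [y]. *)
Lemma adjoint_ex T : exists S : 'B(H), forall x y, ip (T x) y = ip x (S y).
Proof.
have /choice[s sP] : forall y, exists s, forall x, ip (T x) y = ip x s.
  move=> y.
  apply: (@riesz_real _ _ (fun x => ip (T x) y) (opnorm T * nrm y)).
  - by move=> x z; rewrite linearD ipDl.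
  - by move=> a x; rewrite linearZ ipZl.
  - move=> x; rewrite ler_norml lerNl -ipNl; apply/andP; split.
      by apply: le_trans (cauchy_schwarz _ _) _;
        rewrite nrmN mulrAC ler_wpM2r ?nrm_ge0// nrm_op.
    by apply: le_trans (cauchy_schwarz _ _) _;
        rewrite mulrAC ler_wpM2r ?nrm_ge0// nrm_op.
have slin : linear s.
  move=> a x y; apply: ip_ext => z; rewrite ipDr -!sP ipDr; congr (_ + _).
  have ipJ (u v : H) : ip u (a *: v) = ip (a^*%C *: u) v.
    by rewrite /ip linearZr_LR linearZl_LR.
  by rewrite !ipJ -sP linearZ.
have [|S SE] := @bounded_linear_of _ H H s (opnorm T) slin.
  move=> y; have [->|s0] := eqVneq (s y) 0.
    by rewrite nrm0 mulr_ge0 ?opnorm_ge0 ?nrm_ge0.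
  have : 0 < nrm (s y) by rewrite nrm_gt0.
  move/(ler_pM2l) <-; rewrite -expr2 -ip_nrm -sP mulrA.
  apply: le_trans (cauchy_schwarz _ _) _; rewrite ler_wpM2r ?nrm_ge0//.
  by rewrite mulrC nrm_op.
by exists S => x y; rewrite SE.
Qed.

Lemma ip_inner_adj T S : (forall x y, ip (T x) y = ip x (S y)) ->
  forall x y, inner (T x) y = inner x (S y).
Proof.
by move=> h x y; apply: ip_inner => c; rewrite -linearZ h.
Qed.

(** The choice in the definition of [adjoint] has a solution, by
    [adjoint_ex]. *)
Lemma adjointP T x y : ip (T x) y = ip x (adjoint T y).
Proof.
have [S SP] := adjoint_ex T; rewrite /ip /adjoint.
case: xgetP => [_ -> /(_ x y) -> //|/(_ S) []] /=.
exact: ip_inner_adj.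
Qed.

Lemma adjoint_uniq T S : (forall x y, ip (T x) y = ip x (S y)) -> adjoint T = S.
Proof.
by move=> h; apply: bounded_linearP => y; apply: ip_ext => z; rewrite -adjointP h.
Qed.

Lemma adjointK T : adjoint (adjoint T) = T.
Proof. by apply: adjoint_uniq => x y; rewrite ip_sym -adjointP ip_sym. Qed.

Lemma op_mulE S T x : (S * T) x = S (T x). Proof. by []. Qed.
Lemma op_addE S T x : (S + T) x = S x + T x. Proof. by []. Qed.
Lemma op_oppE S x : (- S) x = - S x. Proof. by []. Qed.
Lemma op_scaleE a S x : (a *: S) x = a *: S x. Proof. by []. Qed.
Lemma op_oneE x : (1 : 'B(H)) x = x. Proof. by []. Qed.

Definition op_simp := (op_mulE, op_addE, op_oppE, op_scaleE, op_oneE).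

(** A sequence of operators that is Cauchy in norm converges pointwise. The limit
    is linear and bounded, and the Cauchy bound passes to it. *)
Lemma op_complete (S : nat -> 'B(H)) :
  (forall e : R, 0 < e -> exists n, forall m k, (n <= m)%N -> (n <= k)%N ->
    forall x, nrm ((S m - S k) x) <= e * nrm x) ->
  exists B : 'B(H), forall e : R, 0 < e -> exists n, forall m, (n <= m)%N ->
    forall x, nrm ((S m - B) x) <= e * nrm x.
Proof.
move=> SC.
have /choice[b bP] : forall x, exists b, forall e : R, 0 < e ->
    exists n, forall m, (n <= m)%N -> nrm (S m x - b) <= e.
  move=> x.
  apply: (@nrm_complete R H (fun n => S n x)) => e e0.
  have c0 : 0 < nrm x + 1 by rewrite ltr_wpDl ?nrm_ge0.
  have [n nP] := SC _ (divr_gt0 e0 c0); exists n => m k nm nk.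
  apply: le_trans (nP m k nm nk x) _; rewrite -mulrA ler_piMr ?(ltW e0)//.
  by rewrite mulrC ler_pdivrMr// mul1r lerDl.
have bu (e : R) n : (forall m k, (n <= m)%N -> (n <= k)%N ->
    forall x, nrm ((S m - S k) x) <= e * nrm x) ->
    forall m, (n <= m)%N -> forall x, nrm (S m x - b x) <= e * nrm x.
  move=> nP m nm x; apply/ler_addgt0Pr => d d0.
  have [n1 n1P] := bP x d d0.
  have -> : S m x - b x = (S m - S (maxn n n1)) x + (S (maxn n n1) x - b x).
    by rewrite !op_simp addrA subrK.
  apply: le_trans (nrmD _ _) _; apply: lerD; last exact: n1P (leq_maxr _ _).
  exact: nP m _ nm (leq_maxl _ _) x.
have blin : linear b.
  move=> a x y; apply/eqP; rewrite -subr_eq0 -nrm_eq0 eq_le nrm_ge0 andbT.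
  apply/ler_addgt0Pr => d d0; rewrite add0r.
  pose K := complex.Re `|a| + 2.
  have a0 : 0 <= complex.Re `|a| by rewrite -ler0c RRe_real ?normr_real.
  have K0 : 0 < K by rewrite ltr_wpDl.
  pose e := d / K; have e0 : 0 < e by rewrite divr_gt0.
  have [n1 h1] := bP (a *: x + y) e e0.
  have [n2 h2] := bP x e e0; have [n3 h3] := bP y e e0.
  pose n := maxn n1 (maxn n2 n3).
  have {}h1 := h1 n (leq_maxl _ _).
  have {}h2 := h2 n (leq_trans (leq_maxl _ _) (leq_maxr _ _)).
  have {}h3 := h3 n (leq_trans (leq_maxr _ _) (leq_maxr _ _)).
  have -> : b (a *: x + y) - (a *: b x + b y) =
      a *: (S n x - b x) + (S n y - b y) - (S n (a *: x + y) - b (a *: x + y)).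
    rewrite (linearP (S n)) scalerBr [X in _ = X - _]addrACA -opprD opprB.
    by rewrite [RHS]addrC addrA subrK.
  apply: le_trans (nrmB _ _) _; apply: le_trans (lerD (nrmD _ _) (lexx _)) _.
  rewrite nrmZC; have -> : d = complex.Re `|a| * e + e + e.
    have -> : complex.Re `|a| * e + e + e = K * e by rewrite /K; ring.
    by rewrite mulrC divfK// gt_eqF.
  by rewrite !lerD// ler_wpM2l.
have [n0 n0P] := SC 1 ltr01.
have [|B BE] := @bounded_linear_of _ H H b (opnorm (S n0) + 1) blin.
  move=> x; have -> : b x = S n0 x - (S n0 x - b x).
    by rewrite opprB addrC subrK.
  apply: le_trans (nrmB _ _) _; rewrite mulrDl lerD ?nrm_op//.
  exact: bu n0P n0 (leqnn _) x.
exists B => e e0; have [n nP] := SC e e0; exists n => m nm x.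
by rewrite !op_simp BE; exact: bu nP m nm x.
Qed.

End adjoint.

(** * Weierstrass approximation *)

Section weierstrass.
Context {R : realType}.
Implicit Types (x y e : R) (f : R -> R).

Definition bernstein_weight (n : nat) x (k : nat) : R :=
  'C(n, k)%:R * (x ^+ k * (1 - x) ^+ (n - k)).

(** The absorption identity for binomials. Each use lowers by one the power of
    [k] in a moment of the binomial weights. *)
Lemma sum_mul_bin (n : nat) (F : nat -> R) :
  \sum_(k < n.+2) k%:R * ('C(n.+1, k)%:R * F k) =
  n.+1%:R * \sum_(k < n.+1) 'C(n, k)%:R * F k.+1.
Proof.
rewrite big_ord_recl /= mul0r add0r mulr_sumr; apply: eq_bigr => k _.
by rewrite /bump /= add1n !mulrA -!natrM mul_bin_diag.
Qed.

Lemma bernstein_sum0 n x : \sum_(k < n.+1) bernstein_weight n x k = 1.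
Proof.
have := exprDn (1 - x) x n; rewrite subrK expr1n => ->.
by apply: eq_bigr => k _; rewrite /bernstein_weight (mulrC (x ^+ _)) mulr_natl.
Qed.

Lemma bernstein_sum1 n x : \sum_(k < n.+1) k%:R * bernstein_weight n x k = n%:R * x.
Proof.
case: n => [|n]; first by rewrite big_ord1 !mul0r.
rewrite (sum_mul_bin n (fun k => x ^+ k * (1 - x) ^+ (n.+1 - k))).
congr (_ * _).
transitivity (x * \sum_(k < n.+1) bernstein_weight n x k); last first.
  by rewrite bernstein_sum0 mulr1.
rewrite mulr_sumr.
by apply: eq_bigr => k _; rewrite subSS exprS /bernstein_weight -mulrA mulrCA.
Qed.

Lemma bernstein_sum2 n x :
  \sum_(k < n.+1) k%:R ^+ 2 * bernstein_weight n x k =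
  n%:R * x * (n%:R * x + 1 - x).
Proof.
case: n => [|n]; first by rewrite big_ord1 expr0n !mul0r.
have -> : \sum_(k < n.+2) k%:R ^+ 2 * bernstein_weight n.+1 x k =
    \sum_(k < n.+2) k%:R * ('C(n.+1, k)%:R * (k%:R * (x ^+ k * (1 - x) ^+ (n.+1 - k)))).
  by apply: eq_bigr => k _; rewrite /bernstein_weight expr2 -mulrA [X in _ * X]mulrCA.
rewrite (sum_mul_bin n (fun k => k%:R * (x ^+ k * (1 - x) ^+ (n.+1 - k)))) -!mulrA.
congr (_ * _).
have -> : x * (n.+1%:R * x + 1 - x) = x * (n%:R * x + 1) by rewrite -natr1; ring.
transitivity (x * (\sum_(k < n.+1) k%:R * bernstein_weight n x k +
    \sum_(k < n.+1) bernstein_weight n x k)); last first.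
  by rewrite bernstein_sum1 bernstein_sum0.
rewrite -big_split mulr_sumr /=.
apply: eq_bigr => k _; rewrite subSS exprS /bernstein_weight -natr1.
by move: ((1 - x) ^+ _) (x ^+ _) => u v; ring.
Qed.

Lemma bernstein_variance n x :
  \sum_(k < n.+1) (k%:R - n%:R * x) ^+ 2 * bernstein_weight n x k =
  n%:R * (x * (1 - x)).
Proof.
transitivity (\sum_(k < n.+1) k%:R ^+ 2 * bernstein_weight n x k
    - 2 * (n%:R * x) * (\sum_(k < n.+1) k%:R * bernstein_weight n x k)
    + (n%:R * x) ^+ 2 * \sum_(k < n.+1) bernstein_weight n x k); last first.
  by rewrite bernstein_sum2 bernstein_sum1 bernstein_sum0; ring.
rewrite !mulr_sumr -sumrB -big_split /=.
by apply: eq_bigr => k _; move: (bernstein_weight n x k) => u; ring.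
Qed.

(** Heine's theorem, by covering compactness. Continuity on the whole line allows
    the second point to lie outside the interval. *)
Lemma unif_continuous_itv f (a b e : R) : continuous f -> 0 < e ->
  exists2 d : R, 0 < d & forall x y, a <= x <= b -> `|x - y| < d -> `|f x - f y| < e.
Proof.
move=> cf e0.
have := @segment_compact R a b; rewrite compact_near_coveringP.
move=> /(_ R 0^'+ (fun d x => forall y, `|x - y| < d -> `|f x - f y| < e) _) nc.
have : \forall d \near 0^'+, `[a, b] `<=`
    (fun x => forall y, `|x - y| < d -> `|f x - f y| < e).
  apply: nc => x _.
  have e20 : 0 < e / 2 by rewrite divr_gt0.
  have /cvgrPdist_lt/(_ _ e20) := cf x.
  move=> /nbhs_ballP[d /= d0 dP].
  exists (ball x (d / 2), [set s : R | 0 < s < d / 2]).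
    split; first by apply: nbhsx_ballx; rewrite divr_gt0.
    by near=> s; apply/andP; split; near: s;
      [exact: nbhs_right_gt | apply: nbhs_right_lt; rewrite divr_gt0].
  move=> [z s] [/=]; rewrite -ball_normE /= => xz /andP[s0 sd] y zy.
  have h1 : `|f x - f z| < e / 2.
    by apply: dP; rewrite -ball_normE /=; apply: lt_trans xz _; lra.
  have h2 : `|f x - f y| < e / 2.
    apply: dP; rewrite -ball_normE /=.
    have -> : x - y = (x - z) + (z - y) by ring.
    by apply: le_lt_trans (ler_normD _ _) _; lra.
  have -> : f z - f y = (f x - f y) - (f x - f z) by ring.
  by apply: le_lt_trans (ler_normB _ _) _; lra.
move=> [d /= d0 dP]; exists (d / 2); first by rewrite divr_gt0.
move=> x y xab xy; apply: (dP (d / 2)) => //=.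
- by rewrite sub0r normrN gtr0_norm ?divr_gt0//; lra.
- by rewrite divr_gt0.
Unshelve. all: by end_near. Qed.

Lemma continuous_bounded_itv (f : R -> R) (a b : R) : continuous f ->
  exists2 B : R, 0 < B & forall x, a <= x <= b -> `|f x| <= B.
Proof.
move=> cf; have cpt := @segment_compact R a b.
have fc : {within `[a, b], continuous f} by apply: continuous_subspaceT.
have /pinfty_ex_gt0[B B0 BP] := compact_bounded (continuous_compact fc cpt).
by exists B => // x xab; apply: BP; exists x.
Qed.

(** Bernstein's proof. Uniform continuity and boundedness give
    [`|f x - f y| <= e / 2 + K * (x - y) ^+ 2]. Averaging this over [y = k / N]
    with the binomial weights leaves [e / 2] plus at most [K / N], since the
    variance of the weights is [x * (1 - x) / N]. *)
Lemma weierstrass01 f e : continuous f -> 0 < e ->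
  exists p : {poly R}, forall x, 0 <= x <= 1 -> `|p.[x] - f x| <= e.
Proof.
move=> cf e0; have e20 : 0 < e / 2 by rewrite divr_gt0.
have [d d0 dP] := unif_continuous_itv 0 1 cf e20.
have [B B0 BP] := continuous_bounded_itv 0 1 cf.
pose K := 2 * B / d ^+ 2.
have K0 : 0 < K by rewrite divr_gt0 ?mulr_gt0 ?exprn_gt0.
have fK x y : 0 <= x <= 1 -> 0 <= y <= 1 ->
    `|f x - f y| <= e / 2 + K * (x - y) ^+ 2.
  move=> x01 y01; have [xy|xy] := ltP `|x - y| d.
    by apply: le_trans (ltW (dP x y x01 xy)) _; rewrite lerDl mulr_ge0 ?sqr_ge0 ?ltW.
  have h : 2 * B <= K * (x - y) ^+ 2.
    rewrite /K -mulrA ler_peMr// ?(mulr_ge0 _ (ltW B0))//.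
    rewrite ler_pdivlMl ?exprn_gt0// mulr1.
    by rewrite -[leRHS]real_normK ?num_real// lerXn2r ?nnegrE// ltW.
  apply: le_trans (ler_normB _ _) _; have := BP x x01; have := BP y y01; lra.
have [n _ nP] := near_infty_natSinv_lt (PosNum (divr_gt0 e20 K0)).
have {nP} nP : n.+1%:R^-1 < e / 2 / K := nP n (leqnn n).
set N := n.+1 in nP; have N0 : 0 < N%:R :> R by rewrite ltr0n.
pose p := \sum_(k < N.+1)
  (f (k%:R / N%:R) * 'C(N, k)%:R) *: ('X^k * (1 - 'X) ^+ (N - k)).
exists p => x x01.
have -> : p.[x] = \sum_(k < N.+1) f (k%:R / N%:R) * bernstein_weight N x k.
  rewrite horner_sum; apply: eq_bigr => k _.
  by rewrite !hornerE /bernstein_weight.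
have -> : f x = \sum_(k < N.+1) f x * bernstein_weight N x k.
  by rewrite -mulr_sumr bernstein_sum0 mulr1.
rewrite -sumrB.
have w0 k : 0 <= bernstein_weight N x k.
  by rewrite /bernstein_weight !mulr_ge0 ?exprn_ge0//; lra.
apply: le_trans (ler_norm_sum _ _ _) _.
apply: (@le_trans _ _ (\sum_(k < N.+1) (e / 2 * bernstein_weight N x k +
   K / N%:R ^+ 2 * ((k%:R - N%:R * x) ^+ 2 * bernstein_weight N x k)))).
  apply: ler_sum => k _; rewrite -mulrBl normrM (ger0_norm (w0 k)).
  rewrite [leRHS](_ : _ = (e / 2 + K * (k%:R / N%:R - x) ^+ 2) *
      bernstein_weight N x k).
    rewrite ler_wpM2r//; apply: fK => //.
    rewrite divr_ge0 ?ler0n//= ler_pdivrMr// mul1r ler_nat.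
    by rewrite -ltnS.
  by field; rewrite gt_eqF.
rewrite big_split /= -!mulr_sumr bernstein_sum0 bernstein_variance mulr1.
have -> : K / N%:R ^+ 2 * (N%:R * (x * (1 - x))) = K * (N%:R^-1 * (x * (1 - x))).
  by field; rewrite gt_eqF.
have : N%:R^-1 * (x * (1 - x)) <= e / 2 / K.
  apply: le_trans (ltW nP); rewrite ler_piMr ?invr_ge0 ?ltW//.
  by case/andP: x01 => ? ?; nra.
by rewrite ler_pdivlMr//; lra.
Qed.

(** Rescaling of [weierstrass01]; the factor is [M + 1] so that it is never 0. *)
Lemma weierstrass f (M e : R) : continuous f -> 0 <= M -> 0 < e ->
  exists p : {poly R}, forall x, 0 <= x <= M -> `|p.[x] - f x| <= e.
Proof.
move=> cf M0 e0; pose K := M + 1; have K0 : 0 < K by rewrite ltr_wpDl.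
have cg : continuous (fun t => f (K * t)).
  move=> t; apply: continuous_comp (cf _); apply: cvgM; [exact: cvg_cst|exact: cvg_id].
have [p pP] := weierstrass01 cg e0.
exists (p \Po (K^-1 *: 'X)) => x /andP[x0 xM].
rewrite horner_comp !hornerE.
have := pP (K^-1 * x); rewrite mulrA divff ?gt_eqF// mul1r; apply.
apply/andP; split; first by rewrite mulr_ge0// invr_ge0 ltW.
by rewrite mulrC ler_pdivrMr// mul1r /K; lra.
Qed.

End weierstrass.

(** * Polynomials of a self-adjoint operator *)

Section polynomial_calculus.
Local Open Scope complex_scope.
Context {R : realType} {H : hilbertType R}.
Implicit Types (x y : H) (z : R[i]) (T A S B : 'B(H)) (p q : {poly R[i]}).

Lemma op_scaleAl a S T : (a *: S) * T = a *: (S * T) :> 'B(H).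
Proof. exact: bounded_linearP. Qed.

Lemma op_scaleAr a S T : S * (a *: T) = a *: (S * T) :> 'B(H).
Proof. by apply: bounded_linearP => x; rewrite !op_simp linearZ. Qed.

(** Complex coefficients are needed because a real polynomial of an operator is
    studied by factoring it into linear factors. *)
Definition cpoly p A : 'B(H) := \sum_(i < size p) p`_i *: A ^+ i.

Lemma cpoly_wide n p A : (size p <= n)%N -> cpoly p A = \sum_(i < n) p`_i *: A ^+ i.
Proof.
move=> pn; rewrite /cpoly (big_ord_widen n (fun i => p`_i *: A ^+ i) pn).
rewrite big_mkcond; apply: eq_bigr => i _; case: ltnP => // pi.
by rewrite nth_default// scale0r.
Qed.

Lemma cpolyD p q A : cpoly (p + q) A = cpoly p A + cpoly q A.
Proof.
pose n := maxn (size p) (size q).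
rewrite (@cpoly_wide n (p + q)) ?(leq_trans (size_polyD _ _))//.
rewrite (@cpoly_wide n p) ?leq_maxl// (@cpoly_wide n q) ?leq_maxr//.
by rewrite -big_split /=; apply: eq_bigr => i _; rewrite coefD scalerDl.
Qed.

Lemma cpolyZ a p A : cpoly (a *: p) A = a *: cpoly p A.
Proof.
rewrite (@cpoly_wide (size p)) ?size_scale_leq// scaler_sumr.
by apply: eq_bigr => i _; rewrite coefZ scalerA.
Qed.

Lemma cpolyMX p A : cpoly (p * 'X) A = cpoly p A * A.
Proof.
rewrite (@cpoly_wide (size p).+1) ?(leq_trans (size_polyMleq _ _)) ?size_polyX ?addn2//.
rewrite big_ord_recl coefMX eqxx scale0r add0r mulr_suml.
by apply: eq_bigr => i _; rewrite coefMX lift0 /= op_scaleAl exprSr.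
Qed.

Lemma cpolyC a A : cpoly a%:P A = a *: (1 : 'B(H)).
Proof. by rewrite (@cpoly_wide 1) ?size_polyC_leq1// big_ord1 coefC expr0. Qed.

Lemma cpolyM p q A : cpoly (p * q) A = cpoly p A * cpoly q A.
Proof.
elim/poly_ind: q => [|q c IH].
  by rewrite mulr0 -[0]/(0%:P) cpolyC scale0r mulr0.
rewrite mulrDr mulrA !cpolyD !cpolyMX IH mulrDr mulrA cpolyC; congr (_ + _).
by rewrite mulrC mul_polyC cpolyZ op_scaleAr mulr1.
Qed.

Lemma cpolyXsubC (z : R[i]) A : cpoly ('X - z%:P) A = A - z *: (1 : 'B(H)).
Proof.
rewrite -polyCN cpolyD cpolyC scaleNr -[X in cpoly X]mul1r cpolyMX.
by rewrite -[1]/(1%:P) cpolyC scale1r mul1r.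
Qed.

Lemma op_hornerE (p : {poly R}) A :
  op_horner p A = cpoly (map_poly (real_complex R) p) A.
Proof.
rewrite /op_horner /cpoly size_map_poly.
by apply: eq_bigr => i _; rewrite coef_map.
Qed.

Lemma op_hornerD (p q : {poly R}) A :
  op_horner (p + q) A = op_horner p A + op_horner q A.
Proof. by rewrite !op_hornerE rmorphD cpolyD. Qed.

Lemma op_hornerM (p q : {poly R}) A :
  op_horner (p * q) A = op_horner p A * op_horner q A.
Proof. by rewrite !op_hornerE rmorphM cpolyM. Qed.

Lemma op_hornerC (a : R) A : op_horner a%:P A = a%:C *: (1 : 'B(H)).
Proof. by rewrite op_hornerE map_polyC cpolyC. Qed.

Lemma op_hornerX A : op_horner 'X A = A.
Proof.
by rewrite op_hornerE map_polyX -['X]subr0 -polyC0 cpolyXsubC scale0r subr0.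
Qed.

Lemma op_horner1 A : op_horner 1 A = 1.
Proof. by rewrite -[X in op_horner X]/(1%:P) op_hornerC scale1r. Qed.

Lemma op_hornerN (p : {poly R}) A : op_horner (- p) A = - op_horner p A.
Proof.
by rewrite -mulN1r -[-1]polyCN op_hornerM op_hornerC rmorphN scaleN1r mulN1r.
Qed.

Lemma op_hornerB (p q : {poly R}) A :
  op_horner (p - q) A = op_horner p A - op_horner q A.
Proof. by rewrite op_hornerD op_hornerN. Qed.

Definition selfadj A := forall x y, ip (A x) y = ip x (A y).
(** Positive operators; their real spectrum lies in [[0, opnorm A]], by
    [spectrum_range]. *)
Definition posop A := selfadj A /\ forall x, 0 <= ip (A x) x.

Lemma op_horner_selfadj (p : {poly R}) A : selfadj A -> selfadj (op_horner p A).
Proof.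
move=> sA; elim/poly_ind: p => [|p c IH] x y.
  by rewrite -polyC0 op_hornerC rmorph0 !op_scaleE !scale0r ip0l ip0r.
have comm : op_horner (p * 'X) A = A * op_horner p A.
  by rewrite mulrC op_hornerM op_hornerX.
rewrite op_hornerD op_hornerC [in RHS]comm op_hornerM op_hornerX !op_simp.
by rewrite ipDl ipDr IH sA ipZl ipZr.
Qed.

(** A substitute for invertibility that is stable under products and needs no
    inverse to be built. A scalar [z] for which [A - z] is not bounded below is
    an approximate eigenvalue of [A]. *)
Definition bounded_below A := exists2 c : R, 0 < c & forall x, c * nrm x <= nrm (A x).

Lemma bounded_below1 : bounded_below 1.
Proof. by exists 1 => // x; rewrite mul1r. Qed.

Lemma bounded_belowM S T : bounded_below S -> bounded_below T -> bounded_below (S * T).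
Proof.
move=> [c c0 cS] [d d0 dT]; exists (c * d); first exact: mulr_gt0.
move=> x; apply: le_trans (cS (T x)); rewrite -mulrA ler_wpM2l//; first exact: ltW.
Qed.

(** Factor [p] into linear factors: the operator is then a nonzero multiple of a
    product of operators that are bounded below. *)
Lemma cpoly_bounded_below p A : p != 0 ->
  (forall z, root p z -> bounded_below (A - z *: (1 : 'B(H)))) ->
  bounded_below (cpoly p A).
Proof.
move=> p0; have [r pE] := closed_field_poly_normal p.
set a := lead_coef p in pE.
have a0 : a != 0 by rewrite lead_coef_eq0.
move=> rootp.
have {}rootp z : z \in r -> bounded_below (A - z *: (1 : 'B(H))).
  by move=> zr; apply: rootp; rewrite pE rootZ// root_prod_XsubC.
rewrite pE cpolyZ.
have [c c0 cP] : bounded_below (cpoly (\prod_(z <- r) ('X - z%:P)) A).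
  elim: r {pE} rootp => [|z r IH] rP.
    by rewrite big_nil -[1]/(1%:P) cpolyC scale1r; exact: bounded_below1.
  rewrite big_cons cpolyM cpolyXsubC; apply: bounded_belowM.
    by apply: rP; rewrite mem_head.
  by apply: IH => u ur; apply: rP; rewrite in_cons ur orbT.
have na0 : 0 < complex.Re `|a|.
  by rewrite -ltcR RRe_real ?normr_real// normr_gt0.
exists (complex.Re `|a| * c); first exact: mulr_gt0.
by move=> x; rewrite op_simp nrmZC -mulrA ler_wpM2l// ltW.
Qed.

Lemma nrm_subsq x y (a : R) :
  nrm (x - a%:C *: y) ^+ 2 = nrm x ^+ 2 - 2 * a * ip x y + a ^+ 2 * nrm y ^+ 2.
Proof.
by rewrite -!ip_nrm !(ipDl, ipDr, ipNl, ipNr, ipZl, ipZr) (ip_sym y x); ring.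
Qed.

(** With [m = opnorm S], expanding the square gives
    [nrm (S (S x) - m ^+ 2 x) ^+ 2 <= m ^+ 4 nrm x ^+ 2 - m ^+ 2 nrm (S x) ^+ 2].
    This is small compared with [nrm x ^+ 2] when [nrm (S x)] is close to
    [m * nrm x]; a lower bound would make [opnorm S] smaller than [m]. *)
Lemma opnorm_not_bounded_below S : selfadj S -> (exists x : H, x != 0) ->
  ~ bounded_below (S * S - (opnorm S ^+ 2)%:C *: (1 : 'B(H))).
Proof.
move=> sS [x0 x0N] [c c0 cP].
set m := opnorm S in cP.
have m0 : 0 <= m := opnorm_ge0 S.
have key x : m ^+ 2 * nrm (S x) ^+ 2 <= (m ^+ 4 - c ^+ 2) * nrm x ^+ 2.
  have := cP x; rewrite -(@ler_pXn2r _ 2) ?nnegrE ?mulr_ge0 ?nrm_ge0 ?(ltW c0)//.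
  rewrite !op_simp nrm_subsq sS ip_nrm exprMn.
  have : nrm (S (S x)) ^+ 2 <= m ^+ 2 * nrm (S x) ^+ 2.
    by rewrite -exprMn lerXn2r ?nnegrE ?mulr_ge0 ?nrm_ge0// nrm_op.
  by rewrite -(exprM m 2 2) /=; lra.
have n0 : 0 < nrm x0 ^+ 2 by rewrite exprn_gt0// nrm_gt0.
have c20 : 0 < c ^+ 2 by rewrite exprn_gt0.
have mc : 0 <= m ^+ 4 - c ^+ 2.
  have := le_trans (mulr_ge0 (sqr_ge0 m) (sqr_ge0 (nrm (S x0)))) (key x0).
  by rewrite pmulr_lge0.
have {}m0 : 0 < m.
  rewrite lt_def m0 andbT; apply/eqP => mE.
  by move: mc; rewrite mE expr0n /=; lra.
have m20 : 0 < m ^+ 2 by rewrite exprn_gt0.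
pose d := (m ^+ 4 - c ^+ 2) / m ^+ 2.
have d0 : 0 <= d by rewrite divr_ge0// ltW.
have : opnorm S <= Num.sqrt d.
  apply: opnorm_le; first exact: sqrtr_ge0.
  move=> x; rewrite -(@ler_pXn2r _ 2) ?nnegrE ?mulr_ge0 ?sqrtr_ge0 ?nrm_ge0//.
  by rewrite exprMn sqr_sqrtr// /d mulrAC ler_pdivlMr// mulrC.
rewrite -/m -(@ler_pXn2r _ 2) ?nnegrE ?sqrtr_ge0 ?(ltW m0)// sqr_sqrtr//.
by rewrite /d ler_pdivlMr// -exprD; lra.
Qed.

(** The quadratic form of a self-adjoint operator is real. *)
Lemma selfadj_ip_i S x : selfadj S -> ip (S x) ('i%C *: x) = 0.
Proof.
move=> sS; have h : ip (S x) ('i%C *: x) = - ip (S x) ('i%C *: x).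
  rewrite {1}sS linearZ /= -(ip_i2 x) scalerA -expr2 sqr_i scaleN1r ipNr.
  by rewrite ip_sym.
lra.
Qed.

(** By [selfadj_ip_i], [(A - a) x] and ['i *: x] are orthogonal for the real
    inner product, so the norm of [(A - a) x - b *: ('i *: x)] is at least
    [`|b| * nrm x]. *)
Lemma nonreal_bounded_below A (a b : R) : selfadj A -> b != 0 ->
  bounded_below (A - (a +i* b) *: (1 : 'B(H))).
Proof.
move=> sA b0; exists `|b|; first by rewrite normr_gt0.
move=> x; set y := A x - a%:C *: x.
have -> : (A - (a +i* b) *: (1 : 'B(H))) x = y - b%:C *: ('i%C *: x).
  rewrite !op_simp /y -addrA -opprD scalerA -scalerDl; congr (_ - _ *: _).
  by rewrite [LHS]complexE /= mulrC.
have i0 : ip y ('i%C *: x) = 0.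
  rewrite /y ipDl ipNl ipZl (selfadj_ip_i x sA).
  by rewrite (@selfadj_ip_i 1 x) ?mulr0 ?subr0.
rewrite -(@ler_pXn2r _ 2) ?nnegrE ?mulr_ge0 ?nrm_ge0//.
rewrite nrm_subsq i0 mulr0 subr0 exprMn real_normK ?num_real//.
have -> : nrm ('i%C *: x) = nrm x.
  by rewrite nrmZC normc_def /= expr0n add0r expr1n sqrtr1 mul1r.
by rewrite lerDr sqr_ge0.
Qed.

(** Spectral mapping at the norm. Let [m] be the norm of [p(A)]. The operator
    [p(A) ^+ 2 - m ^+ 2] is not bounded below, so some root of the polynomial
    [p ^+ 2 - m ^+ 2] is an approximate eigenvalue of [A], and approximate
    eigenvalues of [A] are real. *)
Lemma approx_eigenvalue (p : {poly R}) A : selfadj A -> (exists x : H, x != 0) ->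
  exists2 r : R, ~ bounded_below (A - r%:C *: (1 : 'B(H)))
    & `|p.[r]| = opnorm (op_horner p A).
Proof.
move=> sA nt.
have sq_eq (u : R) S : u ^+ 2 = opnorm S ^+ 2 -> `|u| = opnorm S.
  move/eqP; rewrite eqf_sqr => /orP[] /eqP ->; rewrite ?normrN;
    exact/ger0_norm/opnorm_ge0.
have main (q : {poly R}) : q ^+ 2 - (opnorm (op_horner q A) ^+ 2)%:P != 0 ->
  exists2 r : R, ~ bounded_below (A - r%:C *: (1 : 'B(H)))
    & q.[r] ^+ 2 = opnorm (op_horner q A) ^+ 2.
  set m := opnorm _ => q0.
  have nb := opnorm_not_bounded_below (op_horner_selfadj q sA) nt.
  have qE : op_horner (q ^+ 2 - (m ^+ 2)%:P) A =
      op_horner q A * op_horner q A - (m ^+ 2)%:C *: (1 : 'B(H)).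
    by rewrite op_hornerB expr2 op_hornerM op_hornerC.
  rewrite -/m -qE op_hornerE in nb.
  apply: contrapT => nor; apply: nb; apply: cpoly_bounded_below.
    by rewrite map_poly_eq0.
  move=> [a b] rt; have [b0|b0] := eqVneq b 0; last exact: nonreal_bounded_below.
  apply: contrapT => nb; apply: nor; exists a; first by rewrite b0 in nb.
  move: rt; rewrite b0 -[a +i* 0]/(a%:C) fmorph_root /root !hornerE subr_eq0.
  by move/eqP.
(* If [p ^+ 2 - m ^+ 2] is the zero polynomial, every real number is one of its
   roots, and any approximate eigenvalue of [A] will do; one is obtained by
   applying the argument to ['X]. *)
have [q0|] := eqVneq (p ^+ 2 - (opnorm (op_horner p A) ^+ 2)%:P) 0; last first.
  move=> /main[r nr pr]; exists r => //.
  exact: sq_eq pr.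
have [|r nr _] := main 'X.
  rewrite -size_poly_eq0 size_polyDl ?size_polyXn// size_polyN.
  exact: leq_ltn_trans (size_polyC_leq1 _) _.
exists r => //; apply: sq_eq.
have /(congr1 (horner^~ r)) := q0; rewrite !hornerE => /eqP.
by rewrite subr_eq0 => /eqP.
Qed.

Lemma not_bounded_below_range A (r : R) : posop A ->
  ~ bounded_below (A - r%:C *: (1 : 'B(H))) -> 0 <= r <= opnorm A.
Proof.
move=> [sA pA] nb; apply/andP; split; rewrite leNgt; apply/negP => h; apply: nb.
  exists (- r); first by rewrite oppr_gt0.
  move=> x; have [->|x0] := eqVneq x 0; first by rewrite nrm0 mulr0 nrm_ge0.
  have n0 : 0 < nrm x by rewrite nrm_gt0.
  rewrite -(ler_pM2r n0); apply: le_trans (cauchy_schwarz _ _).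
  rewrite !op_simp ipDl ipNl ipZl ip_nrm; have := pA x; lra.
exists (r - opnorm A); first by rewrite subr_gt0.
move=> x; rewrite !op_simp mulrBl.
have -> : r * nrm x = nrm (r%:C *: x).
  by rewrite nrmZ gtr0_norm// (le_lt_trans _ h)// opnorm_ge0.
rewrite lerBlDr; apply: le_trans (lerD (lexx _) (nrm_op A x)).
have {1}-> : r%:C *: x = A x - (A x - r%:C *: x) by rewrite opprB addrC subrK.
by apply: le_trans (nrmB _ _) _; rewrite addrC.
Qed.

Lemma not_bounded_below_spectrum A (z : R[i]) :
  ~ bounded_below (A - z *: (1 : 'B(H))) -> spectrum A z.
Proof.
move=> nb [B [BA _]]; apply: nb.
have c0 : 0 < opnorm B + 1 by rewrite ltr_wpDl ?opnorm_ge0.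
exists (opnorm B + 1)^-1; first by rewrite invr_gt0.
move=> x; rewrite mulrC ler_pdivrMr//.
have {1}-> : x = B ((A - z *: (1 : 'B(H))) x) by rewrite -op_mulE BA.
rewrite mulrC; apply: le_trans (nrm_op _ _) _; rewrite ler_wpM2r ?nrm_ge0//.
by rewrite lerDl.
Qed.

(** The norm of [p(A)] is attained as [`|p.[r]|] at an approximate eigenvalue [r]
    of [A], by [approx_eigenvalue]. Such an [r] lies both in the spectrum and in
    [[0, opnorm A]]. The spectral condition gives uniqueness of the functional
    calculus; the interval gives its existence. *)
Theorem opnorm_horner_le A (p : {poly R}) (c : R) : posop A -> 0 <= c ->
  (forall r, 0 <= r <= opnorm A -> spectrum A r%:C -> `|p.[r]| <= c) ->
  opnorm (op_horner p A) <= c.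
Proof.
move=> pA c0 pc; have [nt|tr] := pselect (exists x : H, x != 0).
  have [r nr <-] := approx_eigenvalue p pA.1 nt.
  by apply: pc; [exact: not_bounded_below_range | exact: not_bounded_below_spectrum].
apply: opnorm_le => // x.
have -> : op_horner p A x = 0.
  by apply/eqP; apply: contra_notT tr => h; exists (op_horner p A x).
by rewrite nrm0 mulr_ge0 ?nrm_ge0.
Qed.

End polynomial_calculus.

(** * The continuous functional calculus of a positive operator *)

Section sequences_tools.
Context {R : realType}.

Lemma uniform_seqP (S : set R) (F : nat -> R -> R) (f : R -> R) :
  {uniform S, F @ \oo --> f} <->
  forall e, 0 < e -> exists N, forall n, (N <= n)%N ->
    forall r, S r -> `|F n r - f r| <= e.
Proof.
split=> [Ff e e0|h].
  have : nbhs (f : {uniform` S -> R}) [set g | forall r, S r -> `|g r - f r| <= e].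
    apply/uniform_nbhs; exists [set xy | ball xy.1 e xy.2]; split.
      exact: entourage_ball (PosNum e0).
    move=> g /= gf r /gf; rewrite -ball_normE /= distrC; exact: ltW.
  by move=> /Ff [N _ NP]; exists N => n Nn r Sr; exact: NP n Nn r Sr.
move=> P /uniform_nbhs [E [entE EP]].
move: entE; rewrite -entourage_ballE => -[e /= e0 eE].
have [N NP] := h (e / 2) (divr_gt0 e0 (ltr0Sn R 1)).
exists N => // n /= Nn; apply: EP => r Sr; apply: eE.
rewrite /= -ball_normE /= distrC; apply: le_lt_trans (NP n Nn r Sr) _; lra.
Qed.

Lemma natSinv_lt (e : R) : 0 < e -> exists N, forall n, (N <= n)%N -> n.+1%:R^-1 <= e.
Proof.
move=> e0; have [N _ NP] := near_infty_natSinv_lt (PosNum e0).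
by exists N => n Nn; apply: ltW; exact: NP n Nn.
Qed.

End sequences_tools.

Section operator_norm_algebra.
Local Open Scope complex_scope.
Context {R : realType} {H : hilbertType R}.
Implicit Types (S T : 'B(H)).

Lemma opnormD S T : opnorm (S + T) <= opnorm S + opnorm T.
Proof.
apply: opnorm_le => [|x]; first by rewrite addr_ge0 ?opnorm_ge0.
by rewrite mulrDl; apply: le_trans (nrmD _ _) _; rewrite lerD ?nrm_op.
Qed.

Lemma opnormN S : opnorm (- S) = opnorm S.
Proof.
apply/le_anti/andP; split; apply: opnorm_le; rewrite ?opnorm_ge0// => x.
  by rewrite op_simp nrmN nrm_op.
by rewrite -nrmN -op_oppE nrm_op.
Qed.

Lemma opnormM S T : opnorm (S * T) <= opnorm S * opnorm T.
Proof.
apply: opnorm_le => [|x]; first by rewrite mulr_ge0 ?opnorm_ge0.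
apply: le_trans (nrm_op S (T x)) _; rewrite -mulrA ler_wpM2l ?opnorm_ge0//.
exact: nrm_op.
Qed.

Lemma opnorm_le0 S : opnorm S <= 0 -> S = 0.
Proof.
move=> S0; apply: bounded_linearP => x; apply/eqP; rewrite -nrm_eq0 eq_le nrm_ge0 andbT.
by apply: le_trans (nrm_op S x) _; rewrite mulr_le0_ge0 ?nrm_ge0.
Qed.

End operator_norm_algebra.

Section functional_calculus.
Local Open Scope complex_scope.
Context {R : realType} {H : hilbertType R}.
Implicit Types (A B S : 'B(H)) (f g : R -> R) (p q : {poly R}).

(** Like [is_cfc], but with uniform approximation on the whole interval
    [[0, opnorm A]], where Weierstrass approximation applies, instead of the
    spectrum. The two agree for positive [A]: see [is_cfc_of_approx] and
    [is_cfc_approx_uniq]. *)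
Definition approx_cfc f A B := forall e : R, 0 < e -> exists p : {poly R},
  (forall r, 0 <= r <= opnorm A -> `|p.[r] - f r| <= e) /\
  opnorm (op_horner p A - B) <= e.

Variables (A : 'B(H)) (posA : posop A).

Let horner_le p c : 0 <= c -> (forall r, 0 <= r <= opnorm A -> `|p.[r]| <= c) ->
  opnorm (op_horner p A) <= c.
Proof. by move=> c0 pc; apply: opnorm_horner_le => // r /pc. Qed.

Lemma approx_cfc_bound f B c : approx_cfc f A B -> 0 <= c ->
  (forall r, 0 <= r <= opnorm A -> `|f r| <= c) -> opnorm B <= c.
Proof.
move=> fB c0 fc; apply/ler_addgt0Pr => e e0.
have [p [pf pB]] := fB (e / 2) (divr_gt0 e0 (ltr0Sn R 1)).
have pc : opnorm (op_horner p A) <= c + e / 2.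
  apply: horner_le; first by lra.
  move=> r rA; have := fc r rA; have := pf r rA.
  have {2}-> : p.[r] = f r + (p.[r] - f r) by ring.
  by move=> ? ?; apply: le_trans (ler_normD _ _) _; lra.
have -> : B = op_horner p A - (op_horner p A - B) by rewrite opprB addrC subrK.
by apply: le_trans (opnormD _ _) _; rewrite opnormN; lra.
Qed.

Lemma approx_cfc_ext f g B : (forall r, 0 <= r <= opnorm A -> f r = g r) ->
  approx_cfc f A B -> approx_cfc g A B.
Proof.
move=> fg fB e e0; have [p [pf pB]] := fB e e0; exists p; split=> // r rA.
by rewrite -fg// pf.
Qed.

Lemma approx_cfc_poly p : approx_cfc (horner p) A (op_horner p A).
Proof.
move=> e e0; exists p; split=> [r _|]; first by rewrite subrr normr0 ltW.
apply: opnorm_le => [|x]; first exact: ltW.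
by rewrite subrr nrm0 mulr_ge0 ?nrm_ge0// ltW.
Qed.

Lemma approx_cfc_id : approx_cfc (horner 'X) A A.
Proof. by rewrite -[X in approx_cfc _ _ X]op_hornerX; exact: approx_cfc_poly. Qed.

Lemma approx_cfc_one : approx_cfc (horner 1) A 1.
Proof. by have := approx_cfc_poly 1; rewrite op_horner1. Qed.

Lemma approx_cfcB f g B B' : approx_cfc f A B -> approx_cfc g A B' ->
  approx_cfc (fun r => f r - g r) A (B - B').
Proof.
move=> fB gB e e0; have e20 : 0 < e / 2 by lra.
have [p [pf pB]] := fB _ e20; have [q [qg qB]] := gB _ e20.
exists (p - q); split=> [r rA|].
  rewrite !hornerE; have -> : p.[r] - q.[r] - (f r - g r) =
    (p.[r] - f r) - (q.[r] - g r) by ring.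
  by apply: le_trans (ler_normB _ _) _; have := pf r rA; have := qg r rA; lra.
rewrite op_hornerB; have -> : op_horner p A - op_horner q A - (B - B') =
   (op_horner p A - B) - (op_horner q A - B').
  by rewrite !opprB addrACA [RHS]addrACA; congr (_ + _); rewrite addrC.
by apply: le_trans (opnormD _ _) _; rewrite opnormN; lra.
Qed.

Lemma approx_cfc_uniq f B B' : approx_cfc f A B -> approx_cfc f A B' -> B = B'.
Proof.
move=> fB fB'; apply/eqP; rewrite -subr_eq0; apply/eqP/opnorm_le0.
apply: (approx_cfc_bound (approx_cfcB fB fB')) => // r _.
by rewrite subrr normr0.
Qed.

Lemma approx_cfcM f g B B' : continuous f -> continuous g ->
  approx_cfc f A B -> approx_cfc g A B' ->
  approx_cfc (fun r => f r * g r) A (B * B').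
Proof.
move=> cf cg fB gB e e0.
have [Kf Kf0 KfP] := continuous_bounded_itv 0 (opnorm A) cf.
have [Kg Kg0 KgP] := continuous_bounded_itv 0 (opnorm A) cg.
pose K := Kf + Kg + 1; have K0 : 0 < K by rewrite /K; lra.
pose d := Num.min 1 (e / K).
have d0 : 0 < d by rewrite lt_min ltr01 divr_gt0.
have d1 : d <= 1 by rewrite ge_min lexx.
have dK : d * Kf + d * Kg + d <= e.
  have : d <= e / K by rewrite ge_min lexx orbT.
  by rewrite ler_pdivlMr// /K; lra.
have [p [pf pB]] := fB _ d0; have [q [qg qB]] := gB _ d0.
have qK r : 0 <= r <= opnorm A -> `|q.[r]| <= Kg + d.
  move=> rA; have := KgP r rA; have := qg r rA.
  have {2}-> : q.[r] = g r + (q.[r] - g r) by ring.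
  by move=> ? ?; apply: le_trans (ler_normD _ _) _; lra.
exists (p * q); split=> [r rA|].
  rewrite hornerM.
  have -> : p.[r] * q.[r] - f r * g r =
    (p.[r] - f r) * q.[r] + f r * (q.[r] - g r) by ring.
  apply: le_trans (ler_normD _ _) _; rewrite !normrM.
  have := ler_pM (normr_ge0 _) (normr_ge0 _) (pf r rA) (qK r rA).
  have := ler_pM (normr_ge0 _) (normr_ge0 _) (KfP r rA) (qg r rA).
  nra.
rewrite op_hornerM.
have -> : op_horner p A * op_horner q A - B * B' =
    (op_horner p A - B) * op_horner q A + B * (op_horner q A - B').
  by rewrite mulrBl mulrBr addrA subrK.
apply: le_trans (opnormD _ _) _.
have qA : opnorm (op_horner q A) <= Kg + d.
  by apply: horner_le qK; rewrite addr_ge0 ?ltW.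
have BK : opnorm B <= Kf by apply: approx_cfc_bound fB (ltW Kf0) KfP.
have := ler_pM (opnorm_ge0 _) (opnorm_ge0 _) pB qA.
have := ler_pM (opnorm_ge0 _) (opnorm_ge0 _) BK qB.
have := opnormM (op_horner p A - B) (op_horner q A).
have := opnormM B (op_horner q A - B').
nra.
Qed.

(** Approximating polynomials of [f] give operators that form a Cauchy sequence,
    by [opnorm_horner_le]. *)
Theorem approx_cfc_ex f : continuous f -> exists B, approx_cfc f A B.
Proof.
move=> cf.
have /choice[p pP] : forall n : nat, exists p : {poly R},
    forall r, 0 <= r <= opnorm A -> `|p.[r] - f r| <= n.+1%:R^-1.
  by move=> n; apply: weierstrass; rewrite ?opnorm_ge0// invr_gt0.
have [|B BP] := @op_complete R H (fun n => op_horner (p n) A).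
  move=> e e0; have e20 : 0 < e / 2 by lra.
  have [N NP] := natSinv_lt e20; exists N => m k Nm Nk x.
  apply: le_trans (nrm_op _ _) _; rewrite ler_wpM2r ?nrm_ge0// -op_hornerB.
  apply: horner_le; first exact: ltW.
  move=> r rA; rewrite !hornerE; have -> : (p m).[r] - (p k).[r] =
     ((p m).[r] - f r) - ((p k).[r] - f r) by ring.
  apply: le_trans (ler_normB _ _) _.
  have := le_trans (pP m r rA) (NP m Nm).
  by have := le_trans (pP k r rA) (NP k Nk); lra.
exists B => e e0; have [N NP] := natSinv_lt e0; have [N' N'P] := BP e e0.
pose n := maxn N N'; exists (p n); split=> [r rA|].
  by apply: le_trans (pP n r rA) _; apply: NP; exact: leq_maxl.
by apply: opnorm_le => [|x]; [exact: ltW|apply: N'P; exact: leq_maxr].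
Qed.

(** Outside the interval, [A - r] is inverted by the functional calculus itself,
    applied to [1 / (t - r)]. This function is made continuous on the whole line
    by clamping [t] to the interval. *)
Lemma spectrum_range (r : R) : spectrum A r%:C -> 0 <= r <= opnorm A.
Proof.
move=> sr; apply: contrapT => rA; apply: sr.
pose c (t : R) := Num.max 0 (Num.min t (opnorm A)).
have cE t : 0 <= t <= opnorm A -> c t = t.
  by move=> /andP[t0 tA]; rewrite /c (min_idPl tA) (max_idPr t0).
have cA t : 0 <= c t <= opnorm A.
  by rewrite /c le_max lexx /= ge_max opnorm_ge0 ge_min lexx orbT.
have cr t : c t - r != 0.
  by rewrite subr_eq0; apply: contra_notN rA => /eqP <-.
have cc : continuous c.
  move=> t; apply: (@continuous_max R R (cst 0) (id \min cst (opnorm A))).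
    exact: cvg_cst.
  by apply: continuous_min; [exact: cvg_id | exact: cvg_cst].
pose g t := (c t - r)^-1.
have cg : continuous g.
  by move=> t; apply: cvgV => //; apply: cvgB; [exact: cc|exact: cvg_cst].
have [B gB] := approx_cfc_ex cg; exists B.
have lin : approx_cfc (horner ('X - r%:P)) A (A - r%:C *: (1 : 'B(H))).
  by have := @approx_cfc_poly ('X - r%:P); rewrite op_hornerB op_hornerX op_hornerC.
have clin : continuous (horner ('X - r%:P)) by exact: continuous_horner.
split; apply: approx_cfc_uniq approx_cfc_one.
  apply: approx_cfc_ext (approx_cfcM cg clin gB lin) => t tA.
  by rewrite /g cE// !hornerE mulVf// -{1}(cE t tA).
apply: approx_cfc_ext (approx_cfcM clin cg lin gB) => t tA.
by rewrite /g cE// !hornerE mulfV// -{1}(cE t tA).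
Qed.

Lemma is_cfc_of_approx f B : approx_cfc f A B -> is_cfc f A B.
Proof.
move=> fB.
have /choice[p pP] : forall n : nat, exists p : {poly R},
    (forall r, 0 <= r <= opnorm A -> `|p.[r] - f r| <= n.+1%:R^-1) /\
     opnorm (op_horner p A - B) <= n.+1%:R^-1.
  by move=> n; apply: fB; rewrite invr_gt0.
exists p; split.
  apply/uniform_seqP => e /natSinv_lt[N NP]; exists N => n Nn r /= sr.
  by apply: le_trans (NP n Nn); apply: (pP n).1; exact: spectrum_range.
apply/cvgrPdist_le => e /natSinv_lt[N NP]; exists N => // n /= Nn.
rewrite sub0r normrN ger0_norm ?opnorm_ge0//.
by apply: le_trans (NP n Nn); exact: (pP n).2.
Qed.

(** Two polynomials close to [f], one on the spectrum and the other on the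
    interval, are close to each other on the points where both estimates hold,
    and these points control the norm by [opnorm_horner_le]. *)
Lemma is_cfc_approx_uniq f B B' : is_cfc f A B -> approx_cfc f A B' -> B = B'.
Proof.
move=> [p [/uniform_seqP pf /cvgrPdist_le pB]] fB'.
apply/eqP; rewrite -subr_eq0; apply/eqP/opnorm_le0.
apply/ler_addgt0Pr => e e0; rewrite add0r; have e40 : 0 < e / 4 by lra.
have [N NP] := pf _ e40; have [N' _ N'P] := pB _ e40.
pose n := maxn N N'.
have {NP}h1 := NP n (leq_maxl _ _).
have := N'P n (leq_maxr _ _); rewrite /= sub0r normrN ger0_norm ?opnorm_ge0// => h2.
have [q [qf qB]] := fB' _ e40.
have h3 : opnorm (op_horner (p n - q) A) <= e / 2.
  apply: opnorm_horner_le => //; first by lra.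
  move=> r rA sr; rewrite !hornerE.
  have -> : (p n).[r] - q.[r] = ((p n).[r] - f r) - (q.[r] - f r) by ring.
  apply: le_trans (ler_normB _ _) _.
  by have := h1 r sr; have := qf r rA; lra.
rewrite op_hornerB in h3.
have -> : B - B' = (op_horner (p n) A - op_horner q A)
   - (op_horner (p n) A - B) + (op_horner q A - B').
  by rewrite opprB [X in _ = X + _]addrC [X in _ = X + _]addrA subrK addrA subrK.
apply: le_trans (opnormD _ _) _; apply: le_trans (lerD (opnormD _ _) (lexx _)) _.
by rewrite opnormN; lra.
Qed.

Theorem cfcE f B : approx_cfc f A B -> cfc f A = B.
Proof.
move=> fB; have := is_cfc_of_approx fB; rewrite /cfc.
case: xgetP => [B' _ fB' _|/(_ B)//]; exact: is_cfc_approx_uniq fB' fB.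
Qed.

Theorem cfcP f : continuous f -> approx_cfc f A (cfc f A).
Proof. by move=> /approx_cfc_ex[B fB]; rewrite (cfcE fB). Qed.

Lemma approx_selfadj f B : approx_cfc f A B -> selfadj B.
Proof.
move=> fB x y; apply/eqP; rewrite -subr_eq0 -normr_le0.
apply/ler_addgt0Pr => e e0; rewrite add0r.
pose K := 2 * (nrm x * nrm y) + 1.
have K0 : 0 < K by rewrite ltr_wpDl// mulr_ge0// mulr_ge0 ?nrm_ge0.
have [p [_ pB]] := fB (e / K) (divr_gt0 e0 K0).
pose D := op_horner p A - B.
have sp := op_horner_selfadj p posA.1 x y.
have BE z : B z = op_horner p A z - D z by rewrite /D !op_simp opprB addrC subrK.
rewrite !BE ipDl ipDr sp ipNl ipNr opprD addrACA subrr add0r opprK.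
have bd u v : `|ip (D u) v| <= e / K * (nrm u * nrm v).
  have hD : nrm (D u) * nrm v <= e / K * (nrm u * nrm v).
    rewrite mulrA ler_wpM2r ?nrm_ge0//; apply: le_trans (nrm_op _ _) _.
    by rewrite ler_wpM2r ?nrm_ge0.
  rewrite ler_norml lerNl -ipNl; apply/andP; split; apply: le_trans hD.
    by rewrite -(nrmN (D u)) cauchy_schwarz.
  exact: cauchy_schwarz.
apply: le_trans (ler_normD _ _) _; rewrite normrN (ip_sym x).
apply: le_trans (lerD (bd x y) (bd y x)) _.
rewrite (mulrC (nrm y)) -mulrDr mulrAC ler_pdivrMr// ler_wpM2l ?(ltW e0)//.
by rewrite /K; lra.
Qed.

End functional_calculus.

(** * Absolute values and the mixed Schwarz inequality *)

Section intertwining.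
Local Open Scope complex_scope.
Context {R : realType} {H : hilbertType R}.
Implicit Types (A B S : 'B(H)) (f g : R -> R) (p q : {poly R}).

Lemma op_horner_intertwine S A B p : S * A = B * S ->
  S * op_horner p A = op_horner p B * S.
Proof.
move=> SAB; elim/poly_ind: p => [|p c IH].
  by rewrite -polyC0 !op_hornerC rmorph0 !scale0r mulr0 mul0r.
rewrite !op_hornerD !op_hornerC !op_hornerM !op_hornerX mulrDr mulrDl.
by rewrite mulrA IH -mulrA SAB mulrA op_scaleAr op_scaleAl mulr1 mul1r.
Qed.

(** The relation passes from [A] and [B] to their polynomials, and then to the
    limit. The same polynomial must approximate [f] for both operators, hence the
    maximum of the two norms. *)
Lemma cfc_intertwine S A B f : posop A -> posop B -> continuous f ->
  S * A = B * S -> S * cfc f A = cfc f B * S.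
Proof.
move=> pA pB cf SAB; apply/eqP; rewrite -subr_eq0; apply/eqP/opnorm_le0.
apply/ler_addgt0Pr => e e0; rewrite add0r.
pose K := 2 * opnorm S + 1.
have K0 : 0 < K by rewrite ltr_wpDl// mulr_ge0// opnorm_ge0.
pose d := e / K; have d0 : 0 < d by rewrite divr_gt0.
pose M := Num.max (opnorm A) (opnorm B).
have [p pf] : exists p : {poly R}, forall x, 0 <= x <= M -> `|p.[x] - f x| <= d.
  by apply: weierstrass => //; rewrite le_max opnorm_ge0.
have close C : posop C -> opnorm C <= M -> opnorm (op_horner p C - cfc f C) <= d.
  move=> pC CM.
  have pf_approx := approx_cfcB (@approx_cfc_poly _ _ C p) (cfcP pC cf).
  apply: (approx_cfc_bound pC pf_approx (ltW d0)).
  by move=> r /andP[r0 rC]; apply: pf; rewrite r0 (le_trans rC).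
have hA : opnorm (op_horner p A - cfc f A) <= d.
  by apply: close; rewrite // le_max lexx.
have hB : opnorm (op_horner p B - cfc f B) <= d.
  by apply: close; rewrite // le_max lexx orbT.
have -> : S * cfc f A - cfc f B * S =
   (op_horner p B - cfc f B) * S - S * (op_horner p A - cfc f A).
  by rewrite mulrBl mulrBr (op_horner_intertwine p SAB) opprB [RHS]addrC addrA subrK.
apply: le_trans (opnormD _ _) _; rewrite opnormN.
have h1 := opnormM (op_horner p B - cfc f B) S.
have h2 := opnormM S (op_horner p A - cfc f A).
have h3 : opnorm (op_horner p B - cfc f B) * opnorm S <= d * opnorm S.
  exact: ler_wpM2r (opnorm_ge0 _) _ _ hB.
have h4 : opnorm S * opnorm (op_horner p A - cfc f A) <= opnorm S * d.
  exact: ler_wpM2l (opnorm_ge0 _) _ _ hA.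
have <- : d * K = e by rewrite /d divfK ?gt_eqF.
apply: le_trans (lerD (le_trans h1 h3) (le_trans h2 h4)) _.
have -> : d * opnorm S + opnorm S * d = d * (2 * opnorm S) by ring.
by rewrite ler_wpM2l ?(ltW d0)// /K lerDl.
Qed.

End intertwining.

Section absolute_value.
Local Open Scope complex_scope.
Context {R : realType} {H : hilbertType R}.
Implicit Types (T : 'B(H)).

Lemma posop_adjoint_mul T : posop (adjoint T * T).
Proof.
split=> [x y|x]; rewrite !op_simp ip_sym -adjointP ?ip_nrm ?sqr_ge0//.
by rewrite -adjointP ip_sym.
Qed.

Lemma opabs_sqr T : opabs T * opabs T = adjoint T * T.
Proof.
have pA := posop_adjoint_mul T; have cs := @sqrt_continuous R.
have hs := cfcP pA cs.
apply: (approx_cfc_uniq pA (approx_cfcM pA cs cs hs hs)).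
apply: approx_cfc_ext (approx_cfc_id _) => r /andP[r0 _].
by rewrite hornerX -expr2 sqr_sqrtr.
Qed.

(** [opabs T] is the square of the self-adjoint operator obtained from the fourth
    root. *)
Lemma opabs_posop T : posop (opabs T).
Proof.
have pA := posop_adjoint_mul T.
have cs : continuous (Num.sqrt \o Num.sqrt : R -> R).
  by move=> x; apply: continuous_comp; exact: sqrt_continuous.
have hs := cfcP pA cs; set B := cfc _ _ in hs.
have -> : opabs T = B * B.
  apply: cfcE => //.
  apply: approx_cfc_ext (approx_cfcM pA cs cs hs hs) => r _.
  by rewrite /= -expr2 sqr_sqrtr// sqrtr_ge0.
have sB := approx_selfadj pA hs.
split=> [x y|x]; first by rewrite !op_simp !sB.
by rewrite op_mulE sB ip_nrm sqr_ge0.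
Qed.

Lemma nrm_opabs T x : nrm (opabs T x) = nrm (T x).
Proof.
apply/eqP; rewrite -(@eqrXn2 _ 2) ?nrm_ge0//; apply/eqP.
by rewrite -!ip_nrm -(opabs_posop T).1 -op_mulE opabs_sqr op_mulE ip_sym -adjointP.
Qed.

Lemma opabs_intertwine T : T * opabs T = opabs (adjoint T) * T.
Proof.
apply: cfc_intertwine; [exact: posop_adjoint_mul | exact: posop_adjoint_mul | | ].
  exact: sqrt_continuous.
by rewrite adjointK mulrA.
Qed.

Lemma cfc_opabs_intertwine T (f : R -> R) : continuous f ->
  T * cfc f (opabs T) = cfc f (opabs (adjoint T)) * T.
Proof.
move=> cf; apply: cfc_intertwine => //; try exact: opabs_posop.
exact: opabs_intertwine.
Qed.

(** The operator part of the mixed Schwarz inequality, for [P = opabs T] and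
    [Q = opabs (adjoint T)]. Split [T = T * kP * fP + T * vP]. In the first term
    [kP] moves to the other side of the inner product, crosses [adjoint T] as
    [kQ], and [Q * kQ] is at most [gQ]; the second term has norm at most [e]. *)
Lemma factored_schwarz T (P Q kP kQ fP gQ uP uQ vP : 'B(H)) x y (e : R) :
  (forall z, nrm (T z) = nrm (P z)) -> (forall z, nrm (adjoint T z) = nrm (Q z)) ->
  uP = 1 - vP -> uP = kP * fP -> Q * kQ = uQ * gQ ->
  opnorm uQ <= 1 -> opnorm (P * vP) <= e ->
  adjoint T * kQ = kP * adjoint T -> selfadj kP ->
  ip (T x) y <= nrm (fP x) * nrm (gQ y) + e * (nrm x * nrm y).
Proof.
move=> nP nQ uv kf Qk u1 Pv intw symk.
have -> : T x = T (kP (fP x)) + T (vP x).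
  by rewrite -linearD -op_mulE -kf uv !op_simp subrK.
rewrite ipDl; apply: lerD.
  rewrite adjointP symk; apply: le_trans (cauchy_schwarz _ _) _.
  apply: (ler_wpM2l (nrm_ge0 _)).
  rewrite -[kP _]op_mulE -intw op_mulE nQ -op_mulE Qk op_mulE.
  by apply: le_trans (nrm_op _ _) _; exact: ler_piMl (nrm_ge0 _) u1.
apply: le_trans (cauchy_schwarz _ _) _; rewrite nP -op_mulE.
rewrite mulrA; apply: (ler_wpM2r (nrm_ge0 _)).
by apply: le_trans (nrm_op _ _) _; exact: ler_wpM2r (nrm_ge0 _) _ _ Pv.
Qed.

(** Without the polar decomposition: where [f] is invertible one would write
    [T = T * f(P)^-1 * f(P)]. Since [f] may vanish at 0, the inverse is replaced
    by [k(t) = g(t) / (t + e)]. Then [k * f = t / (t + e)] is at most 1 and differs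
    from 1 by [v = e / (t + e)], with [t * v] at most [e]; and
    [t * k = g * t / (t + e)]. Conclude with [factored_schwarz] and let [e] tend
    to 0. *)
Theorem mixed_schwarz T (f g : R -> R) x y : continuous f -> continuous g ->
  (forall r, 0 <= r -> f r * g r = r) ->
  ip (T x) y <= nrm (cfc f (opabs T) x) * nrm (cfc g (opabs (adjoint T)) y).
Proof.
move=> cf cg fg; apply/ler_addgt0Pr => d d0.
have [e e0 ed] : exists2 e : R, 0 < e & e * (nrm x * nrm y) <= d.
  have L0 : 0 <= nrm x * nrm y by rewrite mulr_ge0 ?nrm_ge0.
  have L1 : 0 < nrm x * nrm y + 1 by rewrite ltr_wpDl.
  exists (d / (nrm x * nrm y + 1)); first by rewrite divr_gt0.
  by rewrite mulrAC ler_pdivrMr// ler_wpM2l ?(ltW d0)// lerDl.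
have u01 (t : R) : 0 <= t -> `|t / (`|t| + e)| <= 1.
  move=> t0; rewrite ger0_norm// ger0_norm ?divr_ge0 ?addr_ge0 ?(ltW e0)//.
  by rewrite ler_pdivrMr ?ltr_wpDl// mul1r lerDl ltW.
set P := opabs T; set Q := opabs (adjoint T).
have pP : posop P := opabs_posop T.
have pQ : posop Q := opabs_posop (adjoint T).
have den0 (t : R) : `|t| + e != 0 by rewrite gt_eqF// ltr_wpDl.
have cw : continuous (fun t : R => (`|t| + e)^-1).
  move=> t; apply: cvgV => //; apply: cvgD; last exact: cvg_cst.
  exact: norm_continuous.
pose k t := g t * (`|t| + e)^-1; pose u t := t * (`|t| + e)^-1.
pose v (t : R) := e * (`|t| + e)^-1.
have ck : continuous k by move=> t; apply: cvgM; [exact: cg|exact: cw].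
have cu : continuous u by move=> t; apply: cvgM; [exact: cvg_id|exact: cw].
have cv : continuous v by move=> t; apply: cvgM; [exact: cvg_cst|exact: cw].
have cX : continuous (horner 'X : R -> R) by exact: continuous_horner.
have uv : cfc u P = 1 - cfc v P.
  apply: cfcE => //.
  apply: approx_cfc_ext (approx_cfcB (approx_cfc_one P) (cfcP pP cv)) => r /andP[r0 _].
  rewrite /u /v hornerC; have := den0 r; rewrite ger0_norm// => dr.
  by field.
have kf : cfc u P = cfc k P * cfc f P.
  apply: cfcE => //.
  apply: approx_cfc_ext (approx_cfcM pP ck cf (cfcP pP ck) (cfcP pP cf)) => r.
  move=> /andP[r0 _].
  by rewrite /u /k mulrAC (mulrC (g r)) fg.
have Qk : Q * cfc k Q = cfc u Q * cfc g Q.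
  apply: (approx_cfc_uniq pQ (approx_cfcM pQ cX ck (approx_cfc_id Q) (cfcP pQ ck))).
  apply: approx_cfc_ext (approx_cfcM pQ cu cg (cfcP pQ cu) (cfcP pQ cg)) => r _.
  by rewrite /u /k hornerX mulrAC mulrA.
have u1 : opnorm (cfc u Q) <= 1.
  apply: (approx_cfc_bound pQ (cfcP pQ cu) ler01) => r /andP[r0 _].
  exact: u01.
have Pv : opnorm (P * cfc v P) <= e.
  have Pv_approx := approx_cfcM pP cX cv (approx_cfc_id P) (cfcP pP cv).
  apply: (approx_cfc_bound pP Pv_approx (ltW e0)).
  move=> r /andP[r0 _]; rewrite /v hornerX mulrCA normrM (gtr0_norm e0).
  rewrite -[leRHS]mulr1; exact: ler_wpM2l (ltW e0) _ _ (u01 r r0).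
have intw := cfc_opabs_intertwine (adjoint T) ck; rewrite (adjointK T) in intw.
have symk := approx_selfadj pP (cfcP pP ck).
have nP z : nrm (T z) = nrm (P z) by exact/esym/nrm_opabs.
have nQ z : nrm (adjoint T z) = nrm (Q z) by exact/esym/nrm_opabs.
have h := factored_schwarz x y nP nQ uv kf Qk u1 Pv intw symk.
exact: le_trans h (lerD (lexx _) ed).
Qed.

End absolute_value.

(** * Block operators *)

Section block.
Local Open Scope complex_scope.
Context {R : realType} {H : hilbertType R}.
Implicit Types (T F G S : 'B(H)).

Lemma ip_hsum (X Y : hsum H H) : ip X Y = ip X.1 Y.1 + ip X.2 Y.2.
Proof. by rewrite /ip -ReD. Qed.

Lemma nrm_hsum (Z : hsum H H) : nrm Z ^+ 2 = nrm Z.1 ^+ 2 + nrm Z.2 ^+ 2.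
Proof. by rewrite -!ip_nrm; exact: ip_hsum. Qed.

Lemma nrm_sqr_sum F G x : selfadj F -> selfadj G -> 
  nrm (F x) ^+ 2 + nrm (G x) ^+ 2 <= opnorm (F ^+ 2 + G ^+ 2) * nrm x ^+ 2.
Proof.
move=> sF sG; rewrite -!ip_nrm -sF -sG -ipDl.
apply: le_trans (cauchy_schwarz _ _) _.
rewrite ip_nrm [nrm x ^+ 2]expr2 mulrA ler_wpM2r ?nrm_ge0//.
exact: (nrm_op (F ^+ 2 + G ^+ 2)).
Qed.

(** Pair the image of a unit vector [X] with the unit vector in its own
    direction. The pairing is a sum of four entries, each bounded by a product of
    norms; the inequality between arithmetic and geometric means turns them into
    quadratic forms, which are grouped by the component of [X] or [y] that they
    contain. *)
Lemma opnorm_opmx_le T1 T2 T3 T4 F1 F2 F3 F4 G1 G2 G3 G4 :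
  selfadj F1 -> selfadj F2 -> selfadj F3 -> selfadj F4 ->
  selfadj G1 -> selfadj G2 -> selfadj G3 -> selfadj G4 ->
  (forall x y, ip (T1 x) y <= nrm (F1 x) * nrm (G1 y)) ->
  (forall x y, ip (T2 x) y <= nrm (F2 x) * nrm (G2 y)) ->
  (forall x y, ip (T3 x) y <= nrm (F3 x) * nrm (G3 y)) ->
  (forall x y, ip (T4 x) y <= nrm (F4 x) * nrm (G4 y)) ->
  opnorm (opmx T1 T2 T3 T4) <=
    2^-1 * (opnorm (F1 ^+ 2 + F3 ^+ 2) + opnorm (G1 ^+ 2 + G2 ^+ 2)
      + opnorm (F2 ^+ 2 + F4 ^+ 2) + opnorm (G3 ^+ 2 + G4 ^+ 2)).
Proof.
move=> sF1 sF2 sF3 sF4 sG1 sG2 sG3 sG4 h1 h2 h3 h4.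
set c := (X in _ <= X).
have c0 : 0 <= c by rewrite mulr_ge0 ?invr_ge0// !addr_ge0 ?opnorm_ge0.
apply: opnorm_le_unit => // X X1.
set Y := opmx T1 T2 T3 T4 X.
have [Y0|Y0] := eqVneq Y 0; first by rewrite Y0 nrm0.
have b0 : 0 < nrm Y by rewrite nrm_gt0.
pose y := ((nrm Y)^-1)%:C *: Y.
have y1 : nrm y <= 1.
  by rewrite nrmZ ger0_norm ?invr_ge0 ?nrm_ge0// mulVf ?gt_eqF.
have -> : nrm Y = ip Y y.
  by rewrite ipZr ip_nrm expr2 mulKf// gt_eqF.
have unit_le (Z : hsum H H) : nrm Z <= 1 -> nrm Z.1 ^+ 2 <= 1 /\ nrm Z.2 ^+ 2 <= 1.
  move=> Z1; have : nrm Z ^+ 2 <= 1 by rewrite expr_le1// nrm_ge0.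
  rewrite nrm_hsum; have := sqr_ge0 (nrm Z.1).
  by have := sqr_ge0 (nrm Z.2); split; lra.
have [X11 X21] := unit_le X X1.
have [y11 y21] := unit_le y y1.
have YE1 : Y.1 = T1 X.1 + T2 X.2 by [].
have YE2 : Y.2 = T3 X.1 + T4 X.2 by [].
rewrite ip_hsum YE1 YE2 !ipDl.
have amgm (a b z : R) : z <= a * b -> z <= 2^-1 * (a ^+ 2 + b ^+ 2).
  by move=> zab; have := sqr_ge0 (a - b); lra.
have k1 := amgm _ _ _ (h1 X.1 y.1); have k2 := amgm _ _ _ (h2 X.2 y.1).
have k3 := amgm _ _ _ (h3 X.1 y.2); have k4 := amgm _ _ _ (h4 X.2 y.2).
have bd F G z : selfadj F -> selfadj G -> nrm z ^+ 2 <= 1 ->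
    nrm (F z) ^+ 2 + nrm (G z) ^+ 2 <= opnorm (F ^+ 2 + G ^+ 2).
  move=> sF sG z1; apply: le_trans (nrm_sqr_sum z sF sG) _.
  by rewrite ler_piMr ?opnorm_ge0.
have b1 := bd _ _ _ sF1 sF3 X11; have b2 := bd _ _ _ sF2 sF4 X21.
have b3 := bd _ _ _ sG1 sG2 y11; have b4 := bd _ _ _ sG3 sG4 y21.
have {}k1 := lerD (lerD k1 k2) (lerD k3 k4).
apply: le_trans k1 _; rewrite -!mulrDr /c ler_pM2l ?invr_gt0//.
apply: le_trans (lerD (lerD (lerD b1 b3) b2) b4).
by rewrite le_eqVlt; apply/orP; left; apply/eqP; ring.
Qed.

End block.

(** * Functions on the half-line and powers *)

Section half_line.
Context {R : realType}.
Implicit Types (f : R -> R).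

(** A function on the half-line is extended evenly to the whole line, where the
    functional calculus is developed. *)
Lemma continuous_comp_norm f : {within `[0, +oo[, continuous f} ->
  continuous (f \o Num.norm : R -> R).
Proof.
move=> /continuous_within_itvcyP[fc f0] x.
have nc : {for x, continuous (Num.norm : R -> R)} by exact: norm_continuous.
have [->|x0] := eqVneq x 0.
  apply/cvgrPdist_lt => e e0.
  move/cvgrPdist_lt : f0 => /(_ e e0) /= [d /= d0 dP].
  exists d => // y; rewrite /= sub0r normrN normr0 => yd.
  have [->|y0] := eqVneq y 0; first by rewrite normr0 subrr normr0.
  by apply: dP; rewrite /= ?normr_gt0// sub0r normrN normr_id.
apply: continuous_comp nc _; apply: fc.
by rewrite in_itv /= andbT normr_gt0.
Qed.

Lemma powR_norm_continuous (s : R) : 0 <= s -> continuous (fun x : R => `|x| `^ s).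
Proof.
rewrite le_eqVlt => /predU1P[<-|s0] x.
  rewrite (_ : (fun _ => _) = cst 1); first exact: cvg_cst.
  by apply/funext => y; rewrite powRr0.
have [->|x0] := eqVneq x 0.
  apply/cvgrPdist_lt => e e0; rewrite normr0 powR0 ?gt_eqF//.
  near=> y; rewrite sub0r normrN ger0_norm ?powR_ge0//.
  rewrite -(@powRr1 _ e) ?(ltW e0)// -(@mulVf _ s) ?gt_eqF// powRrM.
  rewrite gt0_ltr_powR ?nnegrE ?powR_ge0//.
  near: y; apply: (@cvgr0_norm_lt _ _ _ _ _ (fun y : R => y)) => //.
  exact: powR_gt0.
apply: (@continuous_comp _ _ _ (Num.norm : R -> R) (fun y => y `^ s)).
  exact: norm_continuous.
apply: differentiable_continuous; apply/derivable1_diffP.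
have x1 : 0 < `|x| by rewrite normr_gt0.
by have [] := is_derive1_powR s x1.
Unshelve. all: by end_near. Qed.

Lemma powR_mul_compl (t x : R) : 0 <= t <= 1 -> 0 <= x -> x `^ t * x `^ (1 - t) = x.
Proof.
move=> /andP[t0 t1] x0.
have [->|xN0] := eqVneq x 0; last first.
  by rewrite -powRD ?xN0 ?implybT// addrC subrK powRr1.
have [->|tN0] := eqVneq t 0; last by rewrite powR0 ?mul0r.
by rewrite subr0 powRr1 ?mulr0.
Qed.

End half_line.

Section powers.
Context {R : realType} {H : hilbertType R}.

Lemma cfc_norm (A : 'B(H)) (f : R -> R) : posop A ->
  continuous (f \o Num.norm : R -> R) ->
  cfc f A = cfc (f \o Num.norm) A.
Proof.
move=> pA cf; apply: cfcE => //.
by apply: approx_cfc_ext (cfcP pA cf) => r /andP[r0 _] /=; rewrite ger0_norm.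
Qed.

Lemma oppow_double (A : 'B(H)) (s : R) : posop A -> 0 <= s ->
  oppow A (2 * s) = cfc (fun x => x `^ s) A ^+ 2.
Proof.
move=> pA s0; have cs := powR_norm_continuous s0; have h := cfcP pA cs.
rewrite (cfc_norm pA (f := fun x => x `^ s))// expr2; apply: cfcE => //.
apply: approx_cfc_ext (approx_cfcM pA cs cs h h) => r /andP[r0 _].
by rewrite /= ger0_norm// -expr2 -powR_mulrn ?powR_ge0// -powRrM mulrC.
Qed.

(** The operators [F T] and [G T] stand for the squares so that both the squares
    themselves and powers of doubled exponent are instances. *)
Lemma opnorm_opmx_cfc (T1 T2 T3 T4 : 'B(H)) (f g : R -> R) (F G : 'B(H) -> 'B(H)) :
  continuous (f \o Num.norm : R -> R) -> continuous (g \o Num.norm : R -> R) ->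
  (forall r, 0 <= r -> f r * g r = r) ->
  (forall T, F T = cfc f (opabs T) ^+ 2) -> (forall T, G T = cfc g (opabs T) ^+ 2) ->
  opnorm (opmx T1 T2 T3 T4) <=
    2^-1 * (opnorm (F T1 + F T3) + opnorm (G (adjoint T1) + G (adjoint T2))
          + opnorm (F T2 + F T4) + opnorm (G (adjoint T3) + G (adjoint T4))).
Proof.
move=> cf cg fg FE GE; have pos := @opabs_posop R H.
have sa (h : R -> R) (S : 'B(H)) : continuous (h \o Num.norm : R -> R) ->
    selfadj (cfc h (opabs S)).
  move=> ch; rewrite (cfc_norm (pos S) ch).
  by have := approx_selfadj (pos S) (cfcP (pos S) ch).
have ms (T : 'B(H)) x y : ip (T x) y <=
    nrm (cfc f (opabs T) x) * nrm (cfc g (opabs (adjoint T)) y).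
  rewrite (cfc_norm (pos T) cf) (cfc_norm (pos (adjoint T)) cg).
  by apply: mixed_schwarz => // r r0 /=; rewrite ger0_norm// fg.
rewrite !FE !GE.
by apply: opnorm_opmx_le; try exact: sa; move=> x y; exact: ms.
Qed.

End powers.
Unset Implicit Arguments.
Set Strict Implicit.

Theorem theorem3p3 (R : realType) (H : hilbertType R) (T1 T2 T3 T4 : 'B(H)) :
  (forall f g : R -> R,
    {within `[0, +oo[, continuous f} ->
    {within `[0, +oo[, continuous g} ->
    (forall x : R, 0 <= x -> 0 <= f x) ->
    (forall x : R, 0 <= x -> 0 <= g x) ->
    (forall x : R, 0 <= x -> f x * g x = x) ->
    opnorm (opmx T1 T2 T3 T4) <=
      2^-1 * (opnorm (cfc f (opabs T1) ^+ 2 + cfc f (opabs T3) ^+ 2)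
            + opnorm (cfc g (opabs (adjoint T1)) ^+ 2
                      + cfc g (opabs (adjoint T2)) ^+ 2)
            + opnorm (cfc f (opabs T2) ^+ 2 + cfc f (opabs T4) ^+ 2)
            + opnorm (cfc g (opabs (adjoint T3)) ^+ 2
                      + cfc g (opabs (adjoint T4)) ^+ 2)))
  /\
  (forall t : R, 0 <= t <= 1 ->
    opnorm (opmx T1 T2 T3 T4) <=
      2^-1 * (opnorm (oppow (opabs T1) (2 * t) + oppow (opabs T3) (2 * t))
            + opnorm (oppow (opabs (adjoint T1)) (2 * (1 - t))
                      + oppow (opabs (adjoint T2)) (2 * (1 - t)))
            + opnorm (oppow (opabs T2) (2 * t) + oppow (opabs T4) (2 * t))
            + opnorm (oppow (opabs (adjoint T3)) (2 * (1 - t))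
                      + oppow (opabs (adjoint T4)) (2 * (1 - t))))).
Proof.
split=> [f g cf cg _ _ fg | t t01].
  exact: (opnorm_opmx_cfc T1 T2 T3 T4 (continuous_comp_norm cf)
    (continuous_comp_norm cg) fg
    (F := fun T => cfc f (opabs T) ^+ 2) (G := fun T => cfc g (opabs T) ^+ 2)
    (fun=> erefl) (fun=> erefl)).
have t0 : 0 <= t by case/andP: t01.
have s0 : 0 <= 1 - t by rewrite subr_ge0; case/andP: t01.
apply: (opnorm_opmx_cfc T1 T2 T3 T4 (powR_norm_continuous t0)
  (powR_norm_continuous s0) (fun r => powR_mul_compl t01)
  (F := fun T => oppow (opabs T) (2 * t))
  (G := fun T => oppow (opabs T) (2 * (1 - t)))).
- by move=> T; exact: oppow_double (opabs_posop T) t0.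
- by move=> T; exact: oppow_double (opabs_posop T) s0.
Qed.
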